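(* Let $f\in L^2(\mathbb R_t\times\mathbb R^n_x;H^1(\mathbb R^n_v))\cap L^1(\mathbb R^{1+2n})$ be such that $(\partial_t+v\cdot\nabla_x)f=\nabla_v\cdot S$ in the sense of distributions for some $S\in L^2(\mathbb R^{1+2n};\mathbb R^n)$. Then $$\|f\|_{L^2(\mathbb R^{1+2n})}^{1+\frac{2}{2+4n}}\le C\sqrt{\|\nabla_vf\|_{L^2(\mathbb R^{1+2n})}^2+\|S\|_{L^2(\mathbb R^{1+2n})}^2}\;\|f\|_{L^1(\mathbb R^{1+2n})}^{\frac{2}{2+4n}}$$ for some $C=C(n)>0$.
   Context: Variables $(t,x,v)\in\mathbb R\times\mathbb R^n\times\mathbb R^n$; $\nabla_v$ is the gradient in $v$. *)

(* Defs.v *)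
From HB Require Import structures.
From mathcomp Require Import all_boot all_order all_algebra.
From mathcomp Require Import all_classical all_reals all_analysis.
Set Implicit Arguments. Unset Strict Implicit. Unset Printing Implicit Defensive.
Import Order.TTheory GRing.Theory Num.Theory.
Import numFieldNormedType.Exports.
Local Open Scope ring_scope.

Section Defs.
Variable R : realType.

(* Points of R^k are k-tuples of reals; k.-tuple R carries the product
   (= Borel) sigma-algebra [measure_tuple_display]. *)

(* Iterated Lebesgue integral over R^k (x_0 outermost).  For measurable
   nonnegative / absolutely integrable functions this is the Lebesgue
   integral on R^k (Tonelli / Fubini). *)
Fixpoint itint (k : nat) : (k.-tuple R -> \bar R) -> \bar R :=
  match k with
  | 0 => fun F => F [tuple]
  | k'.+1 => fun F =>
      (\int[@lebesgue_measure R]_x itint (fun t : k'.-tuple R => F [tuple of x :: t]))%E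
  end.

Definition upd k (p : k.-tuple R) (i : 'I_k) (s : R) : k.-tuple R :=
  [tuple (if j == i then s else tnth p j) | j < k].

Definition pderiv k (i : 'I_k) (phi : k.-tuple R -> R) : k.-tuple R -> R :=
  fun p => derive1 (fun s => phi (upd p i s)) (tnth p i).

Fixpoint pderivs k (l : seq 'I_k) (phi : k.-tuple R -> R) : k.-tuple R -> R :=
  match l with
  | [::] => phi
  | i :: l' => pderiv i (pderivs l' phi)
  end.

Definition tcontinuous k (phi : k.-tuple R -> R) : Prop :=
  forall p (e : R), 0 < e -> exists2 d : R, 0 < d &
    forall q, (forall j, `|tnth q j - tnth p j| < d) -> `|phi q - phi p| < e.

Definition smooth k (phi : k.-tuple R -> R) : Prop :=
  forall l : seq 'I_k,
    tcontinuous (pderivs l phi) /\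
    forall (i : 'I_k) p, derivable (fun s => pderivs l phi (upd p i s)) (tnth p i) 1.

Definition compact_support k (phi : k.-tuple R -> R) : Prop :=
  exists M : R, forall p, (exists j, M < `|tnth p j|) -> phi p = 0.

Definition test_fun k (phi : k.-tuple R -> R) : Prop :=
  smooth phi /\ compact_support phi.

(* Phase space R_t x R^n_x x R^n_v as (1+2n)-tuples:
   coordinate 0 is t, 1+i is x_i, 1+n+i is v_i. *)
Definition tidx n : 'I_(2 * n).+1 := ord0.
Definition xidx n (i : 'I_n) : 'I_(2 * n).+1 := inord (1 + i).
Definition vidx n (i : 'I_n) : 'I_(2 * n).+1 := inord (1 + n + i).

Definition vcoord n (p : (2 * n).+1.-tuple R) (i : 'I_n) : R := tnth p (vidx i).

Definition integral_R n (F : (2 * n).+1.-tuple R -> R) : \bar R :=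
  itint (fun p => (F p)%:E).
Definition L1norm n (f : (2 * n).+1.-tuple R -> R) : \bar R :=
  itint (fun p => `|f p|%:E).
Definition L2sq n (f : (2 * n).+1.-tuple R -> R) : \bar R :=
  itint (fun p => (f p ^+ 2)%:E).

End Defs.

(* Main.v *)
Require Import Defs.
From HB Require Import structures.
From mathcomp Require Import all_boot all_order all_algebra.
From mathcomp Require Import all_classical all_reals all_analysis.
From mathcomp Require Import measurable_realfun zify ring lra.
Import Order.TTheory GRing.Theory Num.Theory.
Import numFieldNormedType.Exports.
Set Implicit Arguments. Unset Strict Implicit. Unset Printing Implicit Defensive.
Local Open Scope classical_set_scope.
Local Open Scope ring_scope.

(* Let Q = 2 + 4 n be the homogeneous dimension of the kinetic group, and let f_r
   be the average of f over translates of a smooth bump dilated to scale r.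
   Changing the scale from r to r / 2 changes the product kernel by a sum of
   exact derivatives in the group coordinates.  Integrated against f, a
   derivative in v gives r grad_v f; a derivative in x is the commutator of a
   derivative in v with the transport operator, and a derivative in t is the
   transport operator minus x-derivatives, so that the equation turns each of
   them into r times averages of S and grad_v f.  By Schur's test
   |f_r - f_(r/2)|_2 <= C r (|grad_v f|_2 + |S|_2), and summing over dyadic
   scales |f - f_r|_2 obeys the same bound.  Since
   |f_r|_2 <= C r^(-Q/2) |f|_1, optimizing in r gives the inequality. *)

(** * Lebesgue measure on tuples *)

(** The operator d_t + v . grad_x commutes with left translations of the kinetic group. Applied to a
    kernel in z^{-1} o p it therefore brings out the relative velocity, of size r on the support,
    instead of the unbounded v; this is why the averages are not Euclidean convolutions. The
    hypotheses speak only of test functions, so f is never differentiated: every estimate comes from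
    inserting a kernel as test function. Kernels are products of one-variable functions in sheared
    coordinates. Smoothness, masses and derivatives then become one-variable questions, and a change
    of scale is an exact identity, treated factor by factor. Two obstacles shape the rest. The
    integrals are iterated ones, so a measure on tuples representing them is built before Tonelli,
    Schur's test and dominated convergence can be applied. And the shear depends on z, so the
    convergence of f_r to f in L2 is proved from indicators of boxes by a Dynkin argument. *)

Section TupleLebesgue.
Variable R : realType.
Local Notation lambda := (@lebesgue_measure R).

Definition tcons k (z : measurableTypeR R * k.-tuple R) : k.+1.-tuple R := [tuple of z.1 :: z.2].
Definition tuncons k (p : k.+1.-tuple R) : measurableTypeR R * k.-tuple R :=
  (thead p, [tuple of behead p]).

Lemma tconsK k : cancel (@tcons k) (@tuncons k).
Proof.
move=> [x t]; rewrite /tuncons /tcons /=; congr pair.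
by apply/val_inj.
Qed.

Lemma measurable_tcons k : measurable_fun setT (@tcons k).
Proof. exact: measurable_cons. Qed.

Lemma measurable_tuncons k : measurable_fun setT (@tuncons k).
Proof.
apply/measurable_fun_pair => /=; first exact: measurable_tnth.
exact: measurable_behead.
Qed.

(** No sign or integrability is assumed: the positive and negative parts are measurable by Tonelli,
    and extended subtraction is measurable even where both are infinite. *)
Lemma measurable_integral_section d1 d2 (T1 : measurableType d1) (T2 : measurableType d2)
    (m : {sigma_finite_measure set T2 -> \bar R}) (f : T1 * T2 -> \bar R) :
  measurable_fun [set: T1 * T2] f -> measurable_fun setT (fun x => \int[m]_y f (x, y))%E.
Proof.
move=> mf.
rewrite (_ : (fun x => _) =
  (fun x => \int[m]_y f^\+ (x, y) - \int[m]_y f^\- (x, y))%E); last first.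
  apply/funext => x; rewrite integralE.
  under eq_integral do rewrite funepos_comp/=.
  by under [X in (_ - X)%E = _]eq_integral do rewrite funeneg_comp/=.
apply: emeasurable_funB.
  by apply: measurable_fun_fubini_tonelli_F => //; exact: measurable_funepos.
by apply: measurable_fun_fubini_tonelli_F => //; exact: measurable_funeneg.
Qed.

(** The parameter space [X] is arbitrary because each induction step moves the outermost variable of
    the tuple into it. *)
Lemma measurable_itint d (X : measurableType d) k (F : X * k.-tuple R -> \bar R) :
  measurable_fun setT F -> measurable_fun setT (fun x => itint (fun t => F (x, t))).
Proof.
elim: k d X F => [|k IH] d X F mF /=.
  have mg : measurable_fun setT (fun x : X => (x, [tuple] : 0.-tuple R)).
    by apply/measurable_fun_pair => //=; exact: (@measurable_cst _ _ X (0.-tuple R)).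
  exact: (measurableT_comp mF mg).
apply: (@measurable_integral_section _ _ X _ lambda
  (fun z : X * R => itint (fun t : k.-tuple R => F (z.1, [tuple of z.2 :: t])))).
apply: (IH _ _ (fun z : (X * R) * k.-tuple R => F (z.1.1, [tuple of z.1.2 :: z.2]))).
apply: (measurableT_comp mF); apply/measurable_fun_pair => /=.
  exact: measurableT_comp.
apply: measurable_cons => //.
exact: measurableT_comp.
Qed.

Lemma eq_itint k (F G : k.-tuple R -> \bar R) : F =1 G -> itint F = itint G.
Proof. by move=> /funext ->. Qed.

Definition ltuple_succ k (m : {sigma_finite_measure set (k.-tuple R) -> \bar R})
  : set (k.+1.-tuple R) -> \bar R := pushforward (lambda \x m)%E (@tcons k).

Section ltuple_succ.
Variables (k : nat) (m : {sigma_finite_measure set (k.-tuple R) -> \bar R}).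

HB.instance Definition _ := isMeasurableFun.Build _ _ _ _ (@tcons k) (@measurable_tcons k).

Let ltuple_succ0 : ltuple_succ m set0 = 0%E.
Proof. exact: (measure0 (pushforward (lambda \x m)%E (@tcons k))). Qed.

Let ltuple_succ_ge0 A : (0 <= ltuple_succ m A)%E.
Proof. exact: (measure_ge0 (pushforward (lambda \x m)%E (@tcons k))). Qed.

Let ltuple_succ_sigma_additive : semi_sigma_additive (ltuple_succ m).
Proof.
exact: (@measure_semi_sigma_additive _ _ _ (pushforward (lambda \x m)%E (@tcons k))).
Qed.

HB.instance Definition _ := isMeasure.Build _ _ _ (ltuple_succ m)
  ltuple_succ0 ltuple_succ_ge0 ltuple_succ_sigma_additive.

Let ltuple_succ_sigma_finite : sigma_finite setT (ltuple_succ m).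
Proof.
have /sigma_finiteP[F [TF ndF Foo]] := sigma_finiteT lambda.
have /sigma_finiteP[G [TG ndG Goo]] := sigma_finiteT m.
exists (fun i => @tuncons k @^-1` (F i `*` G i)).
  apply/esym/seteqP; split => // p _.
  have [i _ Fi] : (\bigcup_i F i) (tuncons p).1 by rewrite -TF.
  have [j _ Gj] : (\bigcup_i G i) (tuncons p).2 by rewrite -TG.
  exists (maxn i j) => //; split.
    by move: Fi; apply/subsetPset/ndF/leq_maxl.
  by move: Gj; apply/subsetPset/ndG/leq_maxr.
move=> i; have [mF Fi] := Foo i; have [mG Gi] := Goo i; split.
  rewrite -[X in measurable X]setTI; apply: measurable_tuncons => //.
  exact: measurableX.
rewrite /ltuple_succ /pushforward (_ : _ @^-1` _ = F i `*` G i)//; last first.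
  by apply/funext => z; exact: (congr1 (F i `*` G i) (tconsK z)).
rewrite product_measure1E//; apply: lte_mul_pinfty => //.
by rewrite ge0_fin_numE.
Qed.

HB.instance Definition _ := Measure_isSigmaFinite.Build _ _ _ (ltuple_succ m)
  ltuple_succ_sigma_finite.

End ltuple_succ.

(** Two clauses, one for Tonelli and one for Fubini: an iterated integral of a signed function is
    only identified with an integral under absolute integrability. *)
Definition represents_itint k (m : {sigma_finite_measure set (k.-tuple R) -> \bar R}) :=
  (forall F, measurable_fun setT F -> (forall p, 0 <= F p)%E -> itint F = \int[m]_p F p)%E /\
  (forall F, m.-integrable setT F -> itint F = \int[m]_p F p)%E.

(** Start from the Dirac mass on the empty tuple, then push forward the product of [lambda] with the
    measure of the previous dimension. *)
Lemma exists_tuple_lebesgue k :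
  exists m : {sigma_finite_measure set (k.-tuple R) -> \bar R}, represents_itint m.
Proof.
elim: k => [|k [m [IHp IHi]]].
  exists (\d_([tuple] : 0.-tuple R)); split => F mF.
    by move=> F0 /=; rewrite integral_dirac// diracT mul1e.
  by rewrite integral_dirac ?diracT ?mul1e//; exact: measurable_int mF.
exists (ltuple_succ m); split => F mF.
  move=> F0 /=; rewrite (ge0_integral_pushforward (@measurable_tcons k))//.
  have mFt := measurableT_comp mF (@measurable_tcons k).
  rewrite preimage_setT (fubini_tonelli1 (F \o @tcons k) mFt (fun z => F0 _)).
  apply: eq_integral => x _; rewrite IHp//.
  have mx : measurable_fun setT (fun t : k.-tuple R => [tuple of x :: t]).
    exact: measurable_cons.
  exact: (measurableT_comp mF mx).
have mF' := measurable_int _ mF.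
have iF : (lambda \x m)%E.-integrable setT (F \o @tcons k).
  apply/integrableP; split.
    exact: (measurableT_comp mF' (@measurable_tcons k)).
  have /integrableP[_] := mF.
  rewrite (ge0_integral_pushforward (@measurable_tcons k)) ?preimage_setT//.
  exact: measurableT_comp.
rewrite (integral_pushforward (@measurable_tcons k))//.
rewrite preimage_setT -integral12_prod_meas1//=.
(* Only almost every section of an integrable function is integrable, so the induction hypothesis
   applies to almost every [x]. *)
apply: ae_eq_integral => //.
- apply: (@measurable_itint _ _ _ (fun z : R * k.-tuple R => F [tuple of z.1 :: z.2])).
  exact: (measurableT_comp mF' (@measurable_tcons k)).
- exact: measurable_fubini_F iF.
have := ae_integrable1 iF; apply: filterS => x /= xF _.
by rewrite IHi.
Qed.

(** The measure is chosen from the existence statement. Explicit values of its integrals are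
    obtained by going back to [itint]. *)
Definition leb k : {sigma_finite_measure set (k.-tuple R) -> \bar R} :=
  sval (cid (exists_tuple_lebesgue k)).

Lemma leb_ge0 k (F : k.-tuple R -> \bar R) : measurable_fun setT F ->
  (forall p, 0 <= F p)%E -> itint F = (\int[leb k]_p F p)%E.
Proof. by move=> mF F0; case: (svalP (cid (exists_tuple_lebesgue k))) => + _; apply. Qed.

Lemma leb_integrable k (F : k.-tuple R -> \bar R) : (leb k).-integrable setT F ->
  itint F = (\int[leb k]_p F p)%E.
Proof. by move=> iF; case: (svalP (cid (exists_tuple_lebesgue k))) => _; apply. Qed.

(** The constant [c] absorbs the factor of the outer variable, which is frozen while the inner
    variables are integrated. *)
Lemma itint_prod k (c : R) (g : 'I_k -> R -> R) :
  (forall j, lambda.-integrable setT (EFin \o g j)) ->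
  itint (fun p => (c * \prod_j g j (tnth p j))%:E) =
  (c * \prod_j \int[lambda]_x g j x)%:E.
Proof.
elim: k c g => [|k IH] c g ig; first by rewrite /= !big_ord0.
have E x : itint (fun t : k.-tuple R =>
    (c * \prod_j g j (tnth [tuple of x :: t] j))%:E) =
    ((g ord0 x)%:E * (c * \prod_(j < k) \int[lambda]_x g (lift ord0 j) x)%:E)%E.
  rewrite -EFinM mulrA [g _ _ * c]mulrC -IH//.
  apply: eq_itint => t; rewrite big_ord_recl /= mulrA; congr (_ * _)%:E.
  by apply: eq_bigr => j _; rewrite tnthS.
rewrite /=; under eq_integral do rewrite E.
rewrite integralZr//; last exact: (ig ord0).
rewrite big_ord_recl mulrCA [in RHS]EFinM [in X in _ = (X * _)%E]/Rintegral fineK//.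
exact: integrable_fin_num (ig ord0).
Qed.

End TupleLebesgue.

(** * Smooth functions of one variable *)

Section Smooth1.
Variable R : realType.
Implicit Types f g : R -> R.

Lemma is_derive_cast f g (x d d' : R) : is_derive x (1 : R) f d ->
  f =1 g -> d = d' -> is_derive x (1 : R) g d'.
Proof. by move=> df /funext <- <-. Qed.

(** Derivatives are existentially quantified, so a closure property only needs one derivative
    formula and an induction on the order. *)
Fixpoint diffn (n : nat) f : Prop :=
  if n is n'.+1 then exists2 f', (forall x, is_derive x (1 : R) f (f' x)) & diffn n' f'
  else True.

Definition smooth1 f := forall n, diffn n f.

Lemma diffnW n f : diffn n.+1 f -> diffn n f.
Proof. by elim: n f => // n IH f [f' df dfn]; exists f' => //; exact: IH. Qed.

Lemma diffn_cst n (c : R) : diffn n (cst c).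
Proof.
elim: n c => // n IH c; exists (cst 0) => // x; exact: is_derive_cst.
Qed.

Lemma diffnD n f g : diffn n f -> diffn n g -> diffn n (f + g).
Proof.
elim: n f g => // n IH f g [f' df f'n] [g' dg g'n].
by exists (f' + g') => [x|]; [exact: is_deriveD|exact: IH].
Qed.

Lemma diffnM n f g : diffn n f -> diffn n g -> diffn n (f * g).
Proof.
elim: n f g => // n IH f g fn gn.
have [f' df f'n] := fn; have [g' dg g'n] := gn.
exists (f * g' + g * f'); first by move=> x; exact: is_deriveM.
by apply: diffnD; apply: IH => //; exact: diffnW.
Qed.

Lemma diffnV n f : (forall x, f x != 0) -> diffn n f -> diffn n (fun x => (f x)^-1).
Proof.
move=> f0; elim: n => // n IH fn.
have [f' df f'n] := fn.
exists (cst (-1) * ((fun x => (f x)^-1) * (fun x => (f x)^-1)) * f').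
  move=> x; apply: (is_derive_cast (is_deriveV (f0 x) (df x))) => //.
  by rewrite /= -exprVn expr2 scaleNr /GRing.scale/= !fctE /= mulN1r mulNr.
have Vn := IH (diffnW fn).
by do 2 apply: diffnM => //; [exact: diffn_cst|exact: diffnM].
Qed.

Lemma diffn_affine n f (a b : R) : diffn n f -> diffn n (fun x => f (a * x + b)).
Proof.
elim: n f => // n IH f [f' df f'n].
exists (cst a * (fun x => f' (a * x + b))); last first.
  by apply: diffnM; [exact: diffn_cst|exact: IH].
move=> x.
have dl : is_derive x 1 (fun y : R => a * y + b) a.
  apply: (is_derive_cast (is_deriveD (is_deriveZ a (is_derive_id x (1:R))) (is_derive_cst b x 1))) => //.
  by rewrite addr0 /GRing.scale /= mulr1.
apply: (is_derive_cast (is_derive1_comp (df _) dl)) => //.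
by rewrite mulrC.
Qed.

Lemma smooth1_cst (c : R) : smooth1 (cst c). Proof. by move=> n; exact: diffn_cst. Qed.

Lemma smooth1_id : smooth1 id.
Proof.
move=> [|n] //; exists (cst 1); last exact: diffn_cst.
by move=> x; exact: is_derive_id.
Qed.

Lemma smooth1D f g : smooth1 f -> smooth1 g -> smooth1 (f + g).
Proof. by move=> fs gs n; exact: diffnD. Qed.

Lemma smooth1M f g : smooth1 f -> smooth1 g -> smooth1 (f * g).
Proof. by move=> fs gs n; exact: diffnM. Qed.

Lemma smooth1V f : (forall x, f x != 0) -> smooth1 f -> smooth1 (fun x => (f x)^-1).
Proof. by move=> f0 fs n; exact: diffnV. Qed.

Lemma smooth1_affine f (a b : R) : smooth1 f -> smooth1 (fun x => f (a * x + b)).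
Proof. by move=> fs n; exact: diffn_affine. Qed.

Lemma smooth1_is_derive f x : smooth1 f -> is_derive x (1 : R) f ((derive1 f) x).
Proof.
move=> /(_ 1%N)[f' df _]; have := df x.
by move=> dfx; apply: (is_derive_cast dfx) => //; rewrite derive1E; exact/esym/derive_val.
Qed.

Lemma smooth1_derive f : smooth1 f -> smooth1 (derive1 f).
Proof.
move=> fs n; have [f' df f'n] := fs n.+1.
rewrite (_ : (derive1 f) = f')//; apply/funext => x.
by rewrite derive1E; exact: derive_val.
Qed.

Lemma smooth1_continuous f : smooth1 f -> continuous f.
Proof.
move=> fs x; apply: differentiable_continuous.
by apply/derivable1_diffP; exact: (@ex_derive _ _ _ _ _ _ _ (smooth1_is_derive x fs)).
Qed.

(* The powers of 1/x make the family stable under differentiation. *)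
Definition invexp (m : nat) (x : R) : R :=
  if 0 < x then x^-1 ^+ m * expR (- x^-1) else 0.

(** The exponential series gives x^{-(m+2)} <= (m+2)! e^{1/x} for x > 0, hence x^{-m} e^{-1/x} <=
    (m+2)! x^2. *)
Lemma invexp_quadratic m : exists C : R, forall x, `|invexp m x| <= C * x ^+ 2.
Proof.
exists (m.+2)`!%:R => x; rewrite /invexp; case: ifPn => [x0|_]; last first.
  by rewrite normr0 mulr_ge0// ?sqr_ge0.
have xV : 0 < x^-1 by rewrite invr_gt0.
rewrite ger0_norm; last by rewrite mulr_ge0 ?expR_ge0 ?exprn_ge0// ltW.
rewrite expRN.
rewrite ler_pdivrMr ?expR_gt0//.
have h := expR_ge1Dxn m.+1 (ltW xV).
have f0 : 0 < (m.+2)`!%:R :> R by rewrite ltr0n fact_gt0.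
have {}h : x^-1 ^+ m.+2 <= (m.+2)`!%:R * expR x^-1.
  rewrite -ler_pdivrMl// mulrC; apply: le_trans h; by rewrite lerDr.
rewrite mulrAC; apply: le_trans (ler_wpM2r (sqr_ge0 x) h).
rewrite -addn2 exprD -mulrA -exprMn mulVf ?gt_eqF// expr1n mulr1//.
Qed.

(** The difference quotient at distance h is at most |C| |h|. This settles the point where the two
    branches of [invexp] meet. *)
Lemma is_derive_quadratic f (x C : R) : f x = 0 ->
  (forall y, `|f y| <= C * (y - x) ^+ 2) -> is_derive x (1 : R) f 0.
Proof.
move=> fx0 fC.
have cv : h^-1 *: (f (h *: 1 + x) - f x) @[h --> 0^'] --> (0 : R).
  apply/cvgr0Pnorm_le => e e0.
  have C0 : 0 < `|C| + 1 by rewrite ltr_wpDl.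
  near=> h.
  have h0 : h != 0 by near: h; exact: nbhs_dnbhs_neq.
  have he : `|h| <= e / (`|C| + 1).
    near: h; apply: dnbhs0_le; exact: divr_gt0.
  rewrite fx0 subr0 /GRing.scale/= mulr1 normrM normfV.
  rewrite ler_pdivrMl ?normr_gt0//.
  apply: (le_trans (fC _)); rewrite addrK.
  rewrite -real_normK ?num_real// expr2 mulrA mulrC.
  rewrite ler_pM2l ?normr_gt0//.
  move: he; rewrite ler_pdivlMr//; apply: le_trans.
  rewrite mulrC ler_wpM2l//.
  by rewrite (le_trans (ler_norm _))// lerDl.
apply: DeriveDef; first by apply/cvg_ex; exists 0.
exact/cvg_lim.
Unshelve. all: by end_near. Qed.

Lemma is_derive_near f g (x d : R) : (\forall y \near x, f y = g y) ->
  is_derive x (1 : R) g d -> is_derive x (1 : R) f d.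
Proof.
move=> fg dg; apply: (near_eq_is_derive _ dg); near=> y; apply/esym; near: y; exact: fg.
Unshelve. all: by end_near. Qed.

(** For x < 0 the function is locally zero, for x > 0 the formula is calculus, and at 0 the
    quadratic bound gives derivative 0, which is also the value of the right-hand side there. *)
Lemma is_derive_invexp m x :
  is_derive x (1 : R) (invexp m) (- m%:R * invexp m.+1 x + invexp m.+2 x).
Proof.
have [x0|x0|->] := ltgtP x 0.
- rewrite /invexp ltNge (ltW x0)/= mulr0 addr0.
  apply: (is_derive_near _ (is_derive_cst (0 : R) x (1 : R))).
  near=> y; rewrite ifF//; apply/negbTE; rewrite -leNgt; apply: ltW.
  by near: y; exact: lt_nbhsl.
- have dV : is_derive x (1 : R) (fun y : R => y^-1) (- x ^- 2).
    apply: (is_derive_cast (is_deriveV (lt0r_neq0 x0) (is_derive_id x (1 : R)))) => //.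
    by rewrite /GRing.scale /= mulr1.
  have dE : is_derive x (1 : R) (fun y : R => expR (- y^-1)) (expR (- x^-1) * x ^- 2).
    apply: (is_derive_cast (is_derive1_comp (is_derive_expR _) (is_deriveN dV))) => //.
    by rewrite opprK.
  apply: (@is_derive_near _ (fun y => y^-1 ^+ m * expR (- y^-1))).
    near=> y; rewrite /invexp ifT//.
    by near: y; exact: lt_nbhsr.
  case: m => [|m].
    apply: (is_derive_cast dE); first by move=> y; rewrite expr0 mul1r.
    by rewrite /invexp x0 oppr0 mul0r add0r mulrC exprVn.
  apply: (is_derive_cast (is_deriveM (is_deriveX m.+1 dV) dE)).
    by move=> y; rewrite [LHS]/GRing.mul /= exprfctE.
  rewrite exprfctE /invexp x0 /GRing.scale /=.
  rewrite -!exprVn; set u := x^-1; set E := expR _.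
  rewrite !exprS; ring.
- rewrite /invexp ltxx mulr0 addr0.
  have [C hC] := invexp_quadratic m.
  apply: (@is_derive_quadratic _ _ C); first by rewrite ltxx.
  by move=> y; rewrite subr0; exact: hC.
Unshelve. all: by end_near. Qed.

Lemma smooth1_invexp m : smooth1 (invexp m).
Proof.
move=> n; elim: n m => // n IH m.
exists (cst (- m%:R) * invexp m.+1 + invexp m.+2).
  by move=> x; exact: is_derive_invexp.
by apply: diffnD => //; apply: diffnM => //; exact: diffn_cst.
Qed.

Lemma invexp_le0 m x : x <= 0 -> invexp m x = 0.
Proof. by move=> x0; rewrite /invexp ifF// ltNge x0. Qed.

Lemma invexp_gt0 m x : 0 < x -> 0 < invexp m x.
Proof. by move=> x0; rewrite /invexp x0 mulr_gt0 ?expR_gt0 ?exprn_gt0 ?invr_gt0. Qed.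

Lemma invexp_ge0 m x : 0 <= invexp m x.
Proof.
by have [/(invexp_le0 m) -> //|/(invexp_gt0 m)/ltW] := leP x 0.
Qed.

Definition step_den (x : R) : R := invexp 0 x + invexp 0 (-1 * x + 1).

(** The numbers x and 1 - x are never both nonpositive. *)
Lemma step_den_gt0 x : 0 < step_den x.
Proof.
rewrite /step_den; have [x0|x0] := ltP 0 x.
  by rewrite ltr_pwDl ?invexp_gt0 ?invexp_ge0.
by rewrite ltr_wpDl ?invexp_ge0 ?invexp_gt0//; lra.
Qed.

Definition smooth_step (x : R) : R := invexp 0 x / step_den x.

Lemma smooth1_step : smooth1 smooth_step.
Proof.
apply: (@smooth1M _ (fun x => (step_den x)^-1)); first exact: smooth1_invexp.
apply: smooth1V; first by move=> x; rewrite gt_eqF// step_den_gt0.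
apply: (@smooth1D _ (fun x => invexp 0 (-1 * x + 1))); first exact: smooth1_invexp.
by apply: smooth1_affine; exact: smooth1_invexp.
Qed.

Lemma smooth_step_le0 x : x <= 0 -> smooth_step x = 0.
Proof. by move=> x0; rewrite /smooth_step invexp_le0// mul0r. Qed.

Lemma smooth_step_ge1 x : 1 <= x -> smooth_step x = 1.
Proof.
move=> x1; rewrite /smooth_step /step_den [invexp 0 (_ + _)]invexp_le0; last by lra.
by rewrite addr0 divff// gt_eqF// invexp_gt0; lra.
Qed.

Definition supp01 f := forall x, ~~ (0 <= x <= 1) -> f x = 0.

Lemma derive1_near_cst f (x c : R) : (\forall y \near x, f y = c) -> derive1 f x = 0.
Proof.
move=> fc; rewrite derive1E.
have df : is_derive x (1 : R) f 0.
  by apply: (is_derive_near fc); exact: (is_derive_cst c x 1).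
exact: derive_val.
Qed.

Lemma supp01_derive f : supp01 f -> supp01 (derive1 f).
Proof.
move=> f0 x; rewrite negb_and -!ltNge => /orP[x0|x1]; apply: (@derive1_near_cst _ _ 0).
  near=> y; apply: f0; rewrite negb_and -ltNge; apply/orP; left.
  by near: y; exact: lt_nbhsl.
near=> y; apply: f0; rewrite negb_and -!ltNge; apply/orP; right.
by near: y; exact: lt_nbhsr.
Unshelve. all: by end_near. Qed.

(** Defined as the derivative of a transition from 0 to 1, the bump has mass one without
    normalization and an explicit primitive, from which [step_diff] is built. *)
Definition smooth_bump := derive1 smooth_step.

Lemma smooth1_bump : smooth1 smooth_bump.
Proof. exact/smooth1_derive/smooth1_step. Qed.

Lemma supp01_bump : supp01 smooth_bump.
Proof.
move=> x; rewrite negb_and -!ltNge => /orP[x0|x1].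
  apply: (@derive1_near_cst _ _ 0); near=> y; apply/smooth_step_le0/ltW.
  by near: y; exact: lt_nbhsl.
apply: (@derive1_near_cst _ _ 1); near=> y; apply/smooth_step_ge1/ltW.
by near: y; exact: lt_nbhsr.
Unshelve. all: by end_near. Qed.

(** A primitive of the bump minus its mass-preserving rescaling. Its support stays in [0, 1] for
    [l >= 1], because beyond 1 both steps equal 1 and cancel. *)
Definition step_diff (l x : R) : R := smooth_step x - smooth_step (l * x).

Lemma smooth1_step_diff l : smooth1 (step_diff l).
Proof.
rewrite (_ : step_diff l = smooth_step + cst (-1) * (fun x => smooth_step (l * x + 0))).
  apply: smooth1D; first exact: smooth1_step.
  apply: smooth1M; first exact: smooth1_cst.
  by apply: smooth1_affine; exact: smooth1_step.
by apply/funext => x; rewrite /step_diff !fctE /= addr0 mulN1r.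
Qed.

Lemma supp01_step_diff l : 1 <= l -> supp01 (step_diff l).
Proof.
move=> l1 x; rewrite negb_and -!ltNge /step_diff => /orP[x0|x1].
  rewrite !smooth_step_le0 ?subrr// ?ltW//.
  by rewrite pmulr_rlt0// (lt_le_trans ltr01).
rewrite !smooth_step_ge1 ?subrr//; last exact: ltW.
by rewrite -[leLHS]mulr1 ler_pM// ltW.
Qed.

Lemma derive_step_diff l x : derive1 (step_diff l) x = smooth_bump x - l * smooth_bump (l * x).
Proof.
have d1 := smooth1_is_derive x smooth1_step.
have dl : is_derive x (1 : R) (fun y : R => l * y) l.
  apply: (is_derive_cast (is_deriveZ l (is_derive_id x (1 : R)))) => //.
  by rewrite /GRing.scale /= mulr1.
have d2 := is_derive1_comp (smooth1_is_derive (l * x) smooth1_step) dl.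
have d := is_deriveB d1 d2.
rewrite derive1E (_ : step_diff l = smooth_step - (smooth_step \o ( *%R l)))//.
by rewrite (@derive_val _ _ _ _ _ _ _ d) mulrC.
Qed.

Lemma smooth1_bounded f : smooth1 f -> supp01 f ->
  exists2 M, 0 <= M & forall x, `|f x| <= M.
Proof.
move=> fs f01.
have nfc : {within `[0, 1], continuous (fun x => `|f x|)}.
  apply: continuous_subspaceT => x; apply: (@continuous_comp _ _ _ f).
    exact: smooth1_continuous.
  exact: norm_continuous.
have [c _ hc] := EVT_max (ler01 : (0 : R) <= 1) nfc.
exists `|f c| => // x; have [x01|/f01 ->] := boolP (0 <= x <= 1).
  by apply: hc; rewrite in_itv.
by rewrite normr0.
Qed.

End Smooth1.

(** * Product kernels *)

Section Products.
Variable R : realType.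

(** The induction runs over a duplicate-free list, so that excluding the index [j] removes exactly
    one factor. *)
Lemma is_derive_big_prod (I : finType) (h dh : I -> R -> R) (x : R) :
  (forall k, is_derive x (1 : R) (h k) (dh k x)) ->
  is_derive x (1 : R) (fun s => \prod_k h k s)
    (\sum_j dh j x * \prod_(k | k != j) h k x).
Proof.
move=> hd; have := index_enum_uniq I; move: (index_enum I) => r.
elim: r => [_|a r IH /= /andP[ar ur]].
  apply: (is_derive_cast (is_derive_cst (1 : R) x (1 : R))); last by rewrite big_nil.
  by move=> s; rewrite big_nil.
apply: (is_derive_cast (is_deriveM (hd a) (IH ur))).
  by move=> s; rewrite big_cons.
rewrite big_cons [X in _ = X + _ ]mulrC big_cons eqxx /= addrC; congr (_ + _).
  rewrite /GRing.scale /= ; congr (_ * _).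
  rewrite [LHS]big_seq [RHS]big_seq_cond; apply: eq_bigl => k.
  by case: (boolP (k \in r)) => //= kr; apply/esym; apply: contraNneq ar => <-.
rewrite /GRing.scale /= mulr_sumr big_seq [RHS]big_seq; apply: eq_bigr => j jr.
rewrite big_cons ifT; last by apply: contraNneq ar => ->.
by rewrite mulrCA.
Qed.

Variables (N : nat) (e : N.-tuple R -> 'I_N -> R) (u : 'I_N -> 'I_N -> R).

Definition row_tuple (v : 'rV[R]_N) : N.-tuple R := [tuple v 0 j | j < N].

(** The coordinates are affine in each variable, with slopes independent of the point. A partial
    derivative of a product is then a combination, with constant coefficients, of products of the
    same kind. *)
Hypothesis e_upd : forall p i s j, e (upd p i s) j = e p j + (s - tnth p i) * u i j.
Hypothesis e_cont : forall j, continuous (fun v : 'rV[R]_N => e (row_tuple v) j).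

Definition dfactor (g : 'I_N -> R -> R) (j : 'I_N) : 'I_N -> R -> R :=
  fun k => if k == j then derive1 (g k) else g k.

Lemma dfactorE g j (c : 'I_N -> R) : \prod_k dfactor g j k (c k) =
  derive1 (g j) (c j) * \prod_(k | k != j) g k (c k).
Proof.
rewrite (bigD1 j)//= /dfactor eqxx; congr (_ * _).
by apply: eq_bigr => k /negbTE ->.
Qed.

Lemma smooth1_dfactor g j : (forall k, smooth1 (g k)) -> forall k, smooth1 (dfactor g j k).
Proof. by move=> gs k; rewrite /dfactor; case: ifP => // _; exact: smooth1_derive. Qed.

Definition prodf g (p : N.-tuple R) : R := \prod_j g j (e p j).

Lemma is_derive_prodf g p i : (forall k, smooth1 (g k)) ->
  is_derive (tnth p i) (1 : R) (fun s => prodf g (upd p i s))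
    (\sum_j u i j * prodf (dfactor g j) p).
Proof.
move=> gs.
have dl k : is_derive (tnth p i) (1 : R) (fun s : R => e p k + (s - tnth p i) * u i k) (u i k).
  have d1 := is_deriveB (is_derive_id (tnth p i) (1 : R)) (is_derive_cst (tnth p i) (tnth p i) (1 : R)).
  have d2 := is_deriveD (is_derive_cst (e p k) (tnth p i) (1 : R)) (is_deriveZ (u i k) d1).
  apply: (is_derive_cast d2); first by move=> s; rewrite !fctE /= mulrC.
  by rewrite add0r subr0 /GRing.scale /= mulr1.
have dg k : is_derive (tnth p i) (1 : R) (fun s : R => g k (e p k + (s - tnth p i) * u i k))
    ((fun s => derive1 (g k) (e p k + (s - tnth p i) * u i k) * u i k) (tnth p i)).
  exact: is_derive_cast (is_derive1_comp (smooth1_is_derive _ (gs k)) (dl k)) _ _.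
apply: (is_derive_cast (@is_derive_big_prod _ _
  (fun k s => derive1 (g k) (e p k + (s - tnth p i) * u i k) * u i k) _ dg)).
  by move=> s; apply: eq_bigr => k _; rewrite e_upd.
apply: eq_bigr => j _; rewrite /prodf dfactorE subrr mul0r addr0 mulrAC mulrC; congr (_ * (_ * _)).
by apply: eq_bigr => k _; rewrite mul0r addr0.
Qed.

Lemma pderiv_prodf g i p : (forall k, smooth1 (g k)) ->
  pderiv i (prodf g) p = \sum_j u i j * prodf (dfactor g j) p.
Proof. by move=> gs; rewrite /pderiv derive1E; exact: (@derive_val _ _ _ _ _ _ _ (is_derive_prodf p i gs)). Qed.

(* Linear combinations of products: a class stable under all partial
   derivatives, which makes smoothness a matter of continuity. *)
Inductive prod_class : (N.-tuple R -> R) -> Prop :=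
| PClass0 : prod_class (fun=> 0)
| PClassD c g phi : (forall k, smooth1 (g k)) -> prod_class phi ->
    prod_class (fun p => c * prodf g p + phi p).

Lemma prod_classD phi psi : prod_class phi -> prod_class psi ->
  prod_class (fun p => phi p + psi p).
Proof.
move=> hphi hpsi; elim: hphi => [|c g phi' gs _ IH].
  by under eq_fun do rewrite add0r.
by under eq_fun do rewrite -addrA; exact: PClassD.
Qed.

Lemma prod_class_sum (I : Type) (r : seq I) (c : I -> R) (g : I -> 'I_N -> R -> R) :
  (forall a k, smooth1 (g a k)) -> prod_class (fun p => \sum_(a <- r) c a * prodf (g a) p).
Proof.
move=> gs; elim: r => [|a r IH].
  by under eq_fun do rewrite big_nil; exact: PClass0.
by under eq_fun do rewrite big_cons; exact: PClassD.
Qed.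

Lemma prod_class_derive phi i : prod_class phi ->
  exists2 psi, prod_class psi &
    forall p, is_derive (tnth p i) (1 : R) (fun s => phi (upd p i s)) (psi p).
Proof.
elim=> [|c g phi' gs _ [psi cpsi dpsi]].
  by exists (fun=> 0); [exact: PClass0|move=> p; exact: (is_derive_cst (0 : R))].
exists (fun p => \sum_j (c * u i j) * prodf (dfactor g j) p + psi p).
  apply: prod_classD => //; apply: prod_class_sum => a.
  exact: smooth1_dfactor.
move=> p; apply: (is_derive_cast (is_deriveD (is_deriveZ c (is_derive_prodf p i gs)) (dpsi p))) => //.
congr (_ + _); rewrite /GRing.scale /= mulr_sumr; apply: eq_bigr => j _.
by rewrite mulrA.
Qed.

Lemma prod_class_pderivs phi l : prod_class phi -> prod_class (pderivs l phi).
Proof.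
move=> cphi; elim: l => //= i l /(prod_class_derive i)[psi cpsi dpsi].
rewrite (_ : pderiv i _ = psi)//; apply/funext => p.
by rewrite /pderiv derive1E; exact: (@derive_val _ _ _ _ _ _ _ (dpsi p)).
Qed.

(** Balls of row vectors are the coordinatewise neighbourhoods of [tcontinuous], so the continuity
    library for matrices can be used. *)
Lemma continuous_tcontinuous (phi : N.-tuple R -> R) :
  continuous (fun v : 'rV[R]_N => phi (row_tuple v)) -> tcontinuous phi.
Proof.
move=> phic p eps eps0.
pose v : 'rV[R]_N := \row_j tnth p j.
have vp : row_tuple v = p by apply: eq_from_tnth => j; rewrite tnth_mktuple mxE.
have /(phic v)/nbhs_ballP[d /= d0 hd] : nbhs (phi (row_tuple v)) (ball (phi (row_tuple v)) eps).
  exact: nbhsx_ballx.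
exists d => // q qp; pose w : 'rV[R]_N := \row_j tnth q j.
have wq : row_tuple w = q by apply: eq_from_tnth => j; rewrite tnth_mktuple mxE.
have /hd : ball v d w.
  split=> // i j; rewrite /ball /= !mxE distrC; exact: qp.
by rewrite /= vp wq /ball /= distrC.
Qed.

Lemma continuous_prodf g : (forall k, smooth1 (g k)) ->
  continuous (fun v : 'rV[R]_N => prodf g (row_tuple v)).
Proof.
move=> gs; rewrite /prodf.
elim: (index_enum _) => [|a r IH].
  by under eq_fun do rewrite big_nil; move=> v; exact: cst_continuous.
under eq_fun do rewrite big_cons.
move=> v; apply: continuousM; last exact: IH.
apply: (@continuous_comp _ _ _ (fun v => e (row_tuple v) a) (g a)); first exact: e_cont.
exact: smooth1_continuous.
Qed.

Lemma smooth_prodf g : (forall k, smooth1 (g k)) -> smooth (prodf g).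
Proof.
move=> gs l.
have : prod_class (pderivs l (prodf g)).
  apply: prod_class_pderivs.
  rewrite (_ : prodf g = fun p => 1 * prodf g p + 0); first exact/PClassD/PClass0.
  by apply/funext => p; rewrite mul1r addr0.
move: (pderivs _ _) => phi cphi; split.
  apply: continuous_tcontinuous; elim: cphi => [|c g' phi' gs' _ IH].
    by move=> v; exact: cst_continuous.
  move=> v; apply: (@continuousD _ _ _ (fun v => c * prodf g' (row_tuple v))); last exact: IH.
  apply: continuousM; first exact: cst_continuous.
  exact: continuous_prodf.
move=> i p; have [psi _ dpsi] := prod_class_derive i cphi.
exact: (@ex_derive _ _ _ _ _ _ _ (dpsi p)).
Qed.

End Products.

(** * Kernels in kinetic group coordinates *)

Section Kernel.
Variables (R : realType) (n : nat).
Local Notation N := (2 * n).+1.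
Local Notation T := (N.-tuple R).
Implicit Types (z p : T) (r : R) (j : 'I_N) (i : 'I_n) (g : 'I_N -> R -> R).

(* Homogeneity under kinetic dilations: t ~ r^2, x ~ r^3, v ~ r. *)
Definition hdeg j : nat := if j == 0%N :> nat then 2 else if (j <= n)%N then 3 else 1.

(** The velocity that drags coordinate [j]: x_i sits at index 1 + i and v_i at index 1 + n + i,
    hence the shift by n; the coordinates t and v_i are not dragged. *)
Definition vel z j : R := if (0 < j <= n)%N then tnth z (inord (j + n)) else 0.

(* Coordinates of z^{-1} o p, dilated by 1/r, for the kinetic group law
   (t,x,v) o (s,y,w) = (t+s, x+y+sv, v+w). *)
Definition kcoord r z p j : R :=
  (tnth p j - tnth z j - (tnth p ord0 - tnth z ord0) * vel z j) / r ^+ hdeg j.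

(** The constant derivative of [kcoord r z p j] in the coordinate [k] of [p]; the second term is the
    shear, through which t enters the x coordinates. *)
Definition kslope r z (k j : 'I_N) : R :=
  ((k == j)%:R - (k == ord0)%:R * vel z j) / r ^+ hdeg j.

Definition kprod g r z : T -> R := prodf (kcoord r z) g.

Lemma val_xidx i : xidx i = (1 + i)%N :> nat.
Proof. by rewrite /xidx inordK// mul2n -addnn; have := ltn_ord i; lia. Qed.

Lemma val_vidx i : vidx i = (1 + n + i)%N :> nat.
Proof. by rewrite /vidx inordK// mul2n -addnn; have := ltn_ord i; lia. Qed.

Lemma hdeg_t : hdeg (tidx n) = 2%N. Proof. by []. Qed.

Lemma hdeg_x i : hdeg (xidx i) = 3%N.
Proof. by rewrite /hdeg val_xidx /= add1n ltn_ord. Qed.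

Lemma hdeg_v i : hdeg (vidx i) = 1%N.
Proof. by rewrite /hdeg val_vidx /= ifF//; apply/negbTE; lia. Qed.

Lemma vel_t z : vel z (tidx n) = 0. Proof. by []. Qed.

Lemma vel_x z i : vel z (xidx i) = tnth z (vidx i).
Proof.
rewrite /vel val_xidx add1n ltn_ord /=; congr tnth; rewrite /vidx; congr inord; lia.
Qed.

Lemma vel_v z i : vel z (vidx i) = 0.
Proof. by rewrite /vel val_vidx ifF//; apply/negbTE; lia. Qed.

Lemma big_coord (V : nmodType) (F : 'I_N -> V) :
  \sum_j F j = F (tidx n) + \sum_(i < n) F (xidx i) + \sum_(i < n) F (vidx i).
Proof.
transitivity (\sum_(0 <= k < N) F (inord k)).
  by rewrite big_mkord; apply: eq_bigr => j _; rewrite inord_val.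
rewrite big_nat_recl//= -addrA; congr (_ + _).
  by congr F; apply/val_inj; rewrite /= inordK.
rewrite (@big_cat_nat _ _ _ n)//=; last by lia.
congr (_ + _); first by rewrite big_mkord.
rewrite -{1}[n]add0n big_addn (_ : (2 * n - n = n)%N); last by lia.
by rewrite big_mkord; apply: eq_bigr => k _; congr F; congr inord; lia.
Qed.

(** The homogeneous dimension: 2 from t, 3 from each x_i, 1 from each v_i. *)
Lemma sum_hdeg : (\sum_j hdeg j = 2 + 4 * n)%N.
Proof.
rewrite [LHS](_ : _ = (2 + \sum_(i < n) hdeg (xidx i) + \sum_(i < n) hdeg (vidx i))%N);
  last exact: (big_coord hdeg).
rewrite (eq_bigr (fun=> 3%N) (fun i _ => hdeg_x i)).
rewrite [X in (_ + X)%N](eq_bigr (fun=> 1%N) (fun i _ => hdeg_v i)).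
by rewrite !sum_nat_const card_ord; lia.
Qed.

Lemma kcoord_upd r z p k s j :
  kcoord r z (upd p k s) j = kcoord r z p j + (s - tnth p k) * kslope r z k j.
Proof.
rewrite /kcoord /kslope !tnth_mktuple mulrA -mulrDl; congr (_ / _).
rewrite [j == k]eq_sym [ord0 == k]eq_sym.
case: eqP => [<-|_]; case: eqP => [->|_] /=; ring.
Qed.

Lemma continuous_kcoord r z j : continuous (fun v : 'rV[R]_N => kcoord r z (row_tuple v) j).
Proof.
rewrite /kcoord; under eq_fun do rewrite !tnth_mktuple.
have cc (k : 'I_N) : continuous (fun v : 'rV[R]_N => v 0 k) by exact: coord_continuous.
have cB (k : 'I_N) (c : R) : continuous (fun v : 'rV[R]_N => v 0 k - c).
  move=> v; apply: (@continuousB R R^o _ (fun v : 'rV[R]_N => v 0 k) (cst c) v).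
    exact: cc.
  exact: cst_continuous.
have cM (f : 'rV[R]_N -> R) (c : R) : continuous f -> continuous (fun v => f v * c).
  move=> fc v; apply: (@continuousM R _ f (cst c) v); first exact: fc.
  exact: cst_continuous.
apply: (cM (fun v => v 0 j - tnth z j - (v 0 ord0 - tnth z ord0) * vel z j)) => v.
apply: (@continuousB R R^o _ (fun v : 'rV[R]_N => v 0 j - tnth z j)
  (fun v : 'rV[R]_N => (v 0 ord0 - tnth z ord0) * vel z j) v); first exact: cB.
by apply: cM; exact: cB.
Qed.

Definition good_factors g := forall k, smooth1 (g k) /\ supp01 (g k).

Lemma kprod_eq0 g r z p j : (forall k, supp01 (g k)) ->
  ~~ (0 <= kcoord r z p j <= 1) -> kprod g r z p = 0.
Proof. by move=> gs h; rewrite /kprod /prodf (bigD1 j)//= gs// mul0r. Qed.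

Lemma kprod_neq0 g r z p : (forall k, supp01 (g k)) -> kprod g r z p != 0 ->
  forall j, 0 <= kcoord r z p j <= 1.
Proof. by move=> gs h j; apply: contraNT h => /(kprod_eq0 gs) ->. Qed.

Lemma kcoordK r z p j : 0 < r ->
  tnth p j = tnth z j + (tnth p ord0 - tnth z ord0) * vel z j + r ^+ hdeg j * kcoord r z p j.
Proof.
move=> r0; rewrite /kcoord [r ^+ _ * _]mulrC divfK ?expf_neq0 ?gt_eqF//; ring.
Qed.

Lemma kcoord_t r z p : kcoord r z p ord0 = (tnth p ord0 - tnth z ord0) / r ^+ 2.
Proof. by rewrite /kcoord (vel_t z) mulr0 subr0. Qed.

(** Undo dilation and shear: on the support the elapsed time lies in [0, r^2], so the shear
    displaces coordinate [j] by at most r^2 |[vel z j]|. *)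
Lemma kprod_dist g r z p j : 0 < r -> (forall k, supp01 (g k)) -> kprod g r z p != 0 ->
  `|tnth p j - tnth z j| <= r ^+ 2 * `|vel z j| + r ^+ hdeg j.
Proof.
move=> r0 gs /(kprod_neq0 gs) h.
have -> : tnth p j - tnth z j =
  (tnth p ord0 - tnth z ord0) * vel z j + r ^+ hdeg j * kcoord r z p j.
  by rewrite {1}(kcoordK z p j r0); ring.
apply: le_trans (ler_normD _ _) _; rewrite 2!normrM; apply: lerD.
  rewrite ler_wpM2r//.
  have := h ord0; rewrite kcoord_t => /andP[t0 t1].
  have r2 : 0 < r ^+ 2 by rewrite exprn_gt0.
  move: t0 t1; rewrite ler_pdivlMr// mul0r ler_pdivrMr// mul1r => t0 t1.
  by rewrite ger0_norm.
have /andP[c0 c1] := h j.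
rewrite (ger0_norm (exprn_ge0 _ (ltW r0))) (ger0_norm c0).
by rewrite -[leRHS]mulr1 ler_wpM2l// exprn_ge0// ltW.
Qed.

Lemma test_fun_kprod g r z : 0 < r -> good_factors g -> test_fun (kprod g r z).
Proof.
move=> r0 gg; split.
  apply: (smooth_prodf (u := kslope r z)).
  - by move=> *; exact: kcoord_upd.
  - by move=> *; exact: continuous_kcoord.
  - by move=> k; case: (gg k).
exists (\sum_j (`|tnth z j| + (r ^+ 2 * `|vel z j| + r ^+ hdeg j))) => p [j hj].
apply/eqP; apply: contraTT hj => h; rewrite -leNgt.
have gs k : supp01 (g k) by case: (gg k).
have hj := kprod_dist j r0 gs h.
rewrite (bigD1 j)//= -[leLHS]addr0; apply: lerD; last first.
  by apply: sumr_ge0 => k _; rewrite !addr_ge0// ?mulr_ge0 ?exprn_ge0// ltW.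
rewrite -[tnth p j](subrK (tnth z j)) addrC.
by apply: le_trans (ler_normD _ _) _; rewrite lerD2l.
Qed.

Lemma pderiv_kprod g r z k p : (forall j, smooth1 (g j)) ->
  pderiv k (kprod g r z) p = \sum_j kslope r z k j * kprod (dfactor g j) r z p.
Proof.
move=> gs; apply: pderiv_prodf => //.
by move=> *; exact: kcoord_upd.
Qed.

(** Only t enters several group coordinates, so any other derivative hits a single factor. *)
Lemma pderiv_kprod_neq0 g r z k p : (forall j, smooth1 (g j)) -> k != ord0 ->
  pderiv k (kprod g r z) p = kprod (dfactor g k) r z p / r ^+ hdeg k.
Proof.
move=> gs k0; rewrite pderiv_kprod// (bigD1 k)//= big1 ?addr0.
  by rewrite /kslope eqxx (negbTE k0) mul0r subr0 mul1r mulrC.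
by move=> j jk; rewrite /kslope eq_sym (negbTE jk) (negbTE k0) mul0r subr0 !mul0r.
Qed.

Lemma vidx_neq0 i : vidx i != ord0. Proof. by rewrite -val_eqE /= val_vidx. Qed.

Lemma xidx_neq0 i : xidx i != ord0. Proof. by rewrite -val_eqE /= val_xidx. Qed.

(** Multiplies the kernel by the relative velocity (v_i - w_i) / r while keeping it a product kernel
    with the same supports. *)
Definition mulw i g : 'I_N -> R -> R :=
  fun k => if k == vidx i then (fun s => s * g k s) else g k.

Lemma kprod_mulw i g r z p :
  kprod (mulw i g) r z p = kcoord r z p (vidx i) * kprod g r z p.
Proof.
rewrite /kprod /prodf (bigD1 (vidx i))//= [in RHS](bigD1 (vidx i))//= mulrA.
rewrite /mulw eqxx; congr (_ * _); apply: eq_bigr => k /negbTE -> //.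
Qed.

(** Left invariance of the transport operator: the shear turns the t derivative into d_t - w .
    grad_x, so only v - w remains in front of the x derivatives. It is r times a group coordinate,
    which brings the x terms from r^-3 to the r^-2 of the t term. *)
Lemma transport_kprod g r z p : 0 < r -> (forall j, smooth1 (g j)) ->
  pderiv (tidx n) (kprod g r z) p + \sum_(i < n) vcoord p i * pderiv (xidx i) (kprod g r z) p =
  (kprod (dfactor g (tidx n)) r z p
   + \sum_(i < n) kprod (mulw i (dfactor g (xidx i))) r z p) / r ^+ 2.
Proof.
move=> r0 gs; rewrite pderiv_kprod// big_coord.
rewrite [\sum_(i < n) kslope r z (tidx n) (vidx i) * _]big1 ?addr0; last first.
  move=> i _; rewrite /kslope vel_v eq_sym (negbTE (vidx_neq0 i)).
  by rewrite mulr0 subrr !mul0r.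
have r0' : r != 0 by rewrite gt_eqF.
rewrite /kslope eqxx vel_t mulr0 subr0 mul1r hdeg_t -addrA [in RHS]mulrDl.
congr (_ + _); first by rewrite mulrC.
rewrite -big_split mulr_suml; apply: eq_bigr => i _ /=.
rewrite pderiv_kprod_neq0 ?xidx_neq0// hdeg_x kprod_mulw vel_x /kcoord vel_v hdeg_v.
rewrite eq_sym (negbTE (xidx_neq0 i)) /vcoord mulr0 subr0 expr1 mul1r.
rewrite /= mulr0n /kprod; set K := prodf _ _ _; field.
exact: r0'.
Qed.

Lemma vderiv_kprod g r z p i : (forall j, smooth1 (g j)) ->
  pderiv (vidx i) (kprod g r z) p = kprod (dfactor g (vidx i)) r z p / r.
Proof. by move=> gs; rewrite pderiv_kprod_neq0 ?vidx_neq0// hdeg_v expr1. Qed.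

Lemma good_dfactor g j : good_factors g -> good_factors (dfactor g j).
Proof.
move=> gg k; have [s0 s1] := gg k; rewrite /dfactor; case: ifP => // _.
by split; [exact: smooth1_derive|exact: supp01_derive].
Qed.

Lemma good_mulw g i : good_factors g -> good_factors (mulw i g).
Proof.
move=> gg k; have [s0 s1] := gg k; rewrite /mulw; case: ifP => // _; split.
  by apply: (@smooth1M _ id) => //; exact: smooth1_id.
by move=> x /s1 ->; rewrite mulr0.
Qed.

End Kernel.

(** * Masses, measurability and supports of the kernels *)

Section ScaledIntegrals.
Variable R : realType.
Local Notation lambda := (@lebesgue_measure R).

(* Stated for all rescaled translates, since the shear of the group law moves
   the centre of each factor. *)
Definition has_mass (m : R) (g : R -> R) := forall l a : R, 0 < l ->
  lambda.-integrable setT (fun x => (g ((x - a) / l))%:E) /\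
  \int[lambda]_x g ((x - a) / l) = l * m.

(** Symmetric, unlike the support [0, 1] of the bumps, so that it still contains the group
    coordinates after z and p are exchanged. *)
Definition unit_ball : R -> R := \1_(`[-1, 1]).

Lemma measurable_unit_ball : measurable_fun setT unit_ball.
Proof. exact: measurable_indic. Qed.

Lemma unit_ballE x : unit_ball x = (-1 <= x <= 1)%R%:R.
Proof.
rewrite /unit_ball indicE; congr (nat_of_bool _)%:R.
by apply/idP/idP; rewrite inE /= in_itv.
Qed.

Lemma unit_ball_shift (l a : R) : 0 < l ->
  (fun x => unit_ball ((x - a) / l)) = \1_(`[a - l, a + l]).
Proof.
move=> l0; apply/funext => x; rewrite unit_ballE indicE; congr (nat_of_bool _)%:R.
apply/idP/idP; rewrite inE /= in_itv /= ler_pdivlMr// ler_pdivrMr//.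
  by move=> /andP[h1 h2]; apply/andP; split; lra.
by move=> /andP[h1 h2]; apply/andP; split; lra.
Qed.

Lemma has_mass_unit_ball : has_mass 2 unit_ball.
Proof.
move=> l a l0.
have E x : unit_ball ((x - a) / l) = \1_(`[a - l, a + l]) x.
  by rewrite -unit_ball_shift.
split.
  by under eq_fun do rewrite E; exact: integrable_indic_itv.
rewrite /Rintegral; under eq_integral do rewrite E.
rewrite integral_indic//= setIT lebesgue_measure_itv /= lte_fin ifT; last by lra.
by rewrite -EFinD /=; lra.
Qed.

(** The primitive l times [smooth_step] of (x - a) / l rises from 0 to l across [a, a + l]. *)
Lemma has_mass_bump : has_mass 1 (@smooth_bump R).
Proof.
move=> l a l0.
have l0' : l != 0 by rewrite gt_eqF.
have ala : a < a + l by rewrite ltrDl.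
pose f (x : R) := smooth_bump (l^-1 * x + - (a / l)).
pose F (x : R) := l * smooth_step (l^-1 * x + - (a / l)).
have fE x : smooth_bump ((x - a) / l) = f x by rewrite /f mulrBl [l^-1 * x]mulrC.
have fs : smooth1 f by apply: smooth1_affine; exact: smooth1_bump.
have Fs : smooth1 F.
  apply: (@smooth1M _ (cst l)); first exact: smooth1_cst.
  by apply: smooth1_affine; exact: smooth1_step.
have dF x : derive1 F x = f x.
  have dl : is_derive x (1 : R) (fun x : R => l^-1 * x + - (a / l)) l^-1.
    apply: (is_derive_cast (is_deriveD (is_deriveZ l^-1 (is_derive_id x (1:R)))
      (is_derive_cst (- (a / l)) x 1))) => //.
    by rewrite addr0 /GRing.scale /= mulr1.
  have d2 := is_deriveZ l (is_derive1_comp (smooth1_is_derive _ (@smooth1_step R)) dl).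
  rewrite derive1E (@derive_val _ _ _ _ _ _ _ d2) /GRing.scale /= /f /smooth_bump.
  by rewrite mulrCA divff ?mulr1.
have f0 x : x \notin `[a, a + l] -> f x = 0.
  move=> h; rewrite -fE; apply: supp01_bump; apply: contra h.
  rewrite in_itv /= ler_pdivlMr// ler_pdivrMr// => /andP[h1 h2].
  by apply/andP; split; lra.
have fpatch : EFin \o f = (EFin \o f) \_ `[a, a + l].
  apply/funext => x; rewrite patchE; case: ifPn => //.
  by rewrite notin_setE /= => /negP/f0 fx0; rewrite fx0.
have If : lambda.-integrable `[a, a + l] (EFin \o f).
  apply: continuous_compact_integrable; first exact: segment_compact.
  by apply: continuous_subspaceT; exact: smooth1_continuous.
split.
  under eq_fun do rewrite fE.
  rewrite -[X in integrable _ _ X]/(EFin \o f) fpatch.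
  by apply/(integrable_mkcond _ _).1.
rewrite /Rintegral; under eq_integral do rewrite fE.
rewrite -[X in integral _ _ X]/(EFin \o f) fpatch -integral_mkcond.
rewrite (continuous_FTC2 (F := F))//.
- have e1 : l^-1 * (a + l) + - (a / l) = 1 by field.
  have e0 : l^-1 * a + - (a / l) = 0 by field.
  by rewrite /= /F e1 e0 smooth_step_ge1// smooth_step_le0// mulr0 subr0.
- by apply: continuous_subspaceT; exact: smooth1_continuous.
- split.
  + by move=> x _; exact: (@ex_derive _ _ _ _ _ _ _ (smooth1_is_derive x Fs)).
  + by apply: cvg_at_right_filter; exact: smooth1_continuous.
  + by apply: cvg_at_left_filter; exact: smooth1_continuous.
Qed.

Variable n : nat.
Local Notation N := (2 * n).+1.
Local Notation T := (N.-tuple R).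
Implicit Types (r : R) (z p : T) (g : 'I_N -> R -> R).

(** Time is the outermost variable. Once it is fixed, the shear only translates the centres of the
    other factors, which leaves their masses unchanged, and the powers of r multiply to r^Q. *)
Lemma itint_kprod r z g (m : 'I_N -> R) : 0 < r -> (forall j, has_mass (m j) (g j)) ->
  itint (fun p => (kprod g r z p)%:E) = (r ^+ (2 + 4 * n) * \prod_j m j)%:E.
Proof.
move=> r0 gm.
have rd (j : 'I_N) : 0 < r ^+ hdeg j by rewrite exprn_gt0.
have E x : itint (fun t : (2 * n).-tuple R => (kprod g r z [tuple of x :: t])%:E) =
   ((g ord0 ((x - tnth z ord0) / r ^+ 2))%:E *
   (\prod_(j < 2 * n) (r ^+ hdeg (lift ord0 j) * m (lift ord0 j)))%:E)%E.
  rewrite -EFinM.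
  have <- : \prod_(j < 2 * n) \int[lambda]_y g (lift ord0 j) ((y -
     (tnth z (lift ord0 j) + (x - tnth z ord0) * vel z (lift ord0 j))) / r ^+ hdeg (lift ord0 j)) =
     \prod_(j < 2 * n) (r ^+ hdeg (lift ord0 j) * m (lift ord0 j)).
    by apply: eq_bigr => j _; have [_ ->] := gm (lift ord0 j) (r ^+ hdeg (lift ord0 j))
      (tnth z (lift ord0 j) + (x - tnth z ord0) * vel z (lift ord0 j)) (rd _).
  rewrite -itint_prod; last first.
    by move=> j; have [] := gm (lift ord0 j) (r ^+ hdeg (lift ord0 j))
      (tnth z (lift ord0 j) + (x - tnth z ord0) * vel z (lift ord0 j)) (rd _).
  apply: eq_itint => t; rewrite /kprod /prodf big_ord_recl kcoord_t; congr (_ * _)%:E.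
  by apply: eq_bigr => j _; rewrite /kcoord tnthS opprD addrA.
rewrite /=; under eq_integral do rewrite E.
have [i0 m0] := gm ord0 (r ^+ 2) (tnth z ord0) (exprn_gt0 _ r0).
rewrite integralZr//.
have -> : (\int[lambda]_x (g ord0 ((x - tnth z ord0) / r ^+ 2))%:E = (r ^+ 2 * m ord0)%:E)%E.
  by rewrite -m0 /Rintegral fineK//; exact: integrable_fin_num i0.
rewrite -EFinM; congr EFin.
transitivity (\prod_(j < N) (r ^+ hdeg j * m j)); first by rewrite [RHS]big_ord_recl.
by rewrite big_split /= prodrXr sum_hdeg.
Qed.

Lemma measurable_kcoord r (j : 'I_N) :
  measurable_fun setT (fun q : T * T => kcoord r q.1 q.2 j).
Proof.
have m1 k : measurable_fun setT (fun q : T * T => tnth q.1 k).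
  exact: (measurableT_comp (measurable_tnth k) measurable_fst).
have m2 k : measurable_fun setT (fun q : T * T => tnth q.2 k).
  exact: (measurableT_comp (measurable_tnth k) measurable_snd).
apply: measurable_funM; last exact: measurable_cst.
apply: measurable_funB; first exact: measurable_funB.
apply: measurable_funM; first exact: measurable_funB.
rewrite /vel; case: (0 < j <= n)%N; first exact: m1.
exact: measurable_cst.
Qed.

Lemma measurable_kprod r g : (forall j, measurable_fun setT (g j)) ->
  measurable_fun setT (fun q : T * T => kprod g r q.1 q.2).
Proof.
move=> mg; apply: measurable_prod => j _.
exact: (measurableT_comp (mg j) (measurable_kcoord r j)).
Qed.

Lemma measurable_kprod2 r g z : (forall j, measurable_fun setT (g j)) ->
  measurable_fun setT (kprod g r z).
Proof. by move=> mg; exact: (measurableT_comp (measurable_kprod r mg) (pair1_measurable z)). Qed.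

Lemma coord_ind (P : 'I_N -> Prop) : P (tidx n) -> (forall i, P (xidx i)) ->
  (forall i, P (vidx i)) -> forall j, P j.
Proof.
move=> Pt Px Pv j; have jN := ltn_ord j.
have [j0|j0] := eqVneq (j : nat) 0%N.
  by rewrite (_ : j = tidx n)//; exact/val_inj.
have [jn|jn] := leqP j n.
  have j1 : (j.-1 < n)%N by lia.
  by rewrite (_ : j = xidx (Ordinal j1))//; apply/val_inj; rewrite /= val_xidx /=; lia.
have j1 : (j - n.+1 < n)%N by lia.
by rewrite (_ : j = vidx (Ordinal j1))//; apply/val_inj; rewrite /= val_vidx /=; lia.
Qed.

Definition kball r z p : R := kprod (fun=> unit_ball) r z p.

Lemma kballE r z p : kball r z p = [forall j, -1 <= kcoord r z p j <= 1]%R%:R.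
Proof.
rewrite /kball /kprod /prodf; case: forallP => [h|/forallP].
  by rewrite big1// => j _; rewrite unit_ballE h.
rewrite negb_forall => /existsP[j hj].
by rewrite (bigD1 j)//= unit_ballE (negbTE hj) mul0r.
Qed.

(* Symmetric in z and p, which gives both marginal bounds of Schur's test from
   a single volume computation. *)
Definition kboth r z p : R := kball r z p * kball r p z.

Lemma kboth01 r z p : 0 <= kboth r z p <= 1.
Proof.
by rewrite /kboth !kballE; case: [forall _, _]; case: [forall _, _];
  rewrite ?(mulr0, mul0r, mulr1) ?lexx ?ler01.
Qed.

(** With group coordinates (t, x, v) of p seen from z, those of z seen from p are (-t, -(x - t v),
    -v). If the first three lie in [0, 1], all of these lie in [-1, 1]. *)
Lemma kprod_kboth g r z p : 0 < r -> (forall k, supp01 (g k)) -> kprod g r z p != 0 ->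
  kboth r z p = 1.
Proof.
move=> r0 gs /(kprod_neq0 gs) h; have r0' : r != 0 by rewrite gt_eqF.
rewrite /kboth !kballE.
have -> : [forall j, -1 <= kcoord r z p j <= 1].
  by apply/forallP => j; have /andP[? ?] := h j; apply/andP; split; lra.
have -> : [forall j, -1 <= kcoord r p z j <= 1]; last by rewrite mulr1.
apply/forallP; apply: coord_ind => [|i|i].
- have -> : kcoord r p z (tidx n) = - kcoord r z p (tidx n).
    by rewrite /kcoord !vel_t !mulr0 !subr0 -mulNr opprB.
  by have /andP[? ?] := h (tidx n); apply/andP; split; lra.
- have -> : kcoord r p z (xidx i) = - (kcoord r z p (xidx i) -
      kcoord r z p (tidx n) * kcoord r z p (vidx i)).
    rewrite /kcoord !vel_t !vel_x !vel_v hdeg_t hdeg_x hdeg_v.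
    by field.
  have /andP[t0 t1] := h (tidx n); have /andP[v0 v1] := h (vidx i).
  have /andP[x0 x1] := h (xidx i); apply/andP; split; nra.
- have -> : kcoord r p z (vidx i) = - kcoord r z p (vidx i).
    by rewrite /kcoord !vel_v !mulr0 !subr0 -mulNr opprB.
  by have /andP[? ?] := h (vidx i); apply/andP; split; lra.
Qed.

Definition kvol r : R := r ^+ (2 + 4 * n) * 2 ^+ N.

Lemma measurable_kball r : measurable_fun setT (fun q : T * T => kball r q.1 q.2).
Proof. by apply: measurable_kprod => j; exact: measurable_unit_ball. Qed.

Lemma measurable_kboth r : measurable_fun setT (fun q : T * T => kboth r q.1 q.2).
Proof.
apply: measurable_funM; first exact: measurable_kball.
have ms : measurable_fun setT (fun q : T * T => (q.2, q.1)).
  by apply/measurable_fun_pair.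
exact: (measurableT_comp (measurable_kball r) ms).
Qed.

Lemma kball_ge0 r z p : 0 <= kball r z p. Proof. by rewrite kballE. Qed.

Lemma kball_le1 r z p : kball r z p <= 1. Proof. by rewrite kballE; case: [forall _, _]. Qed.

Lemma integral_kball r z : 0 < r -> (\int[leb R N]_p (kball r z p)%:E = (kvol r)%:E)%E.
Proof.
move=> r0; rewrite -leb_ge0; last 2 first.
- apply/measurable_EFinP; apply: measurable_kprod2 => j; exact: measurable_unit_ball.
- by move=> p; rewrite lee_fin kball_ge0.
rewrite (@itint_kprod r z (fun=> unit_ball) (fun=> 2))//; last first.
  by move=> j; exact: has_mass_unit_ball.
by rewrite prodr_const card_ord.
Qed.

End ScaledIntegrals.

(** * Schur's test *)

Section Schur.
Context d (X : measurableType d) (R : realType).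
Variable mu : {sigma_finite_measure set X -> \bar R}.
Implicit Types (F G : X -> R).

Lemma le_integrable_EFin F G : measurable_fun setT F -> (forall x, `|F x| <= G x) ->
  mu.-integrable setT (EFin \o G) -> mu.-integrable setT (EFin \o F).
Proof.
move=> mF FG; apply: le_integrable => //; first exact/measurable_EFinP.
by move=> x _ /=; rewrite lee_fin (le_trans (FG x))// ler_norm.
Qed.

Definition sqnorm F : \bar R := (\int[mu]_x ((F x) ^+ 2)%:E)%E.

Definition kernel_op (k : X * X -> R) F (z : X) : R := \int[mu]_p (F p * k (z, p)).

Definition square_integrable F := measurable_fun setT F /\ (sqnorm F < +oo)%E.

Lemma square_integrableP F : square_integrable F ->
  mu.-integrable setT (fun x => ((F x) ^+ 2)%:E).
Proof.
move=> [mF F2]; apply/integrableP; split.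
  by apply/measurable_EFinP; exact: measurable_funX.
rewrite (eq_integral (fun x => ((F x) ^+ 2)%:E))//.
by move=> x _; rewrite gee0_abs// lee_fin sqr_ge0.
Qed.

Lemma sqnorm_ge0 F : (0 <= sqnorm F)%E.
Proof. by apply: integral_ge0 => x _; rewrite lee_fin sqr_ge0. Qed.

Lemma sqnorm_le F G : measurable_fun setT F -> measurable_fun setT G ->
  (forall x, (F x) ^+ 2 <= (G x) ^+ 2) -> (sqnorm F <= sqnorm G)%E.
Proof.
move=> mF mG FG; apply: ge0_le_integral => //.
- by move=> x _; rewrite lee_fin sqr_ge0.
- by apply/measurable_EFinP; exact: measurable_funX.
- by apply/measurable_EFinP; exact: measurable_funX.
- by move=> x _; rewrite lee_fin.
Qed.

Variables (k w : X * X -> R) (M V : R).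
Hypothesis mk : measurable_fun setT k.
Hypothesis mw : measurable_fun setT w.
Hypothesis w01 : forall z, 0 <= w z <= 1.
Hypothesis V0 : 0 < V.
Hypothesis kw : forall z, `|k z| <= M * w z.
Hypothesis wr : forall z, (\int[mu]_p (w (z, p))%:E <= V%:E)%E.
Hypothesis wl : forall p, (\int[mu]_z (w (z, p))%:E <= V%:E)%E.

Let mkz z : measurable_fun setT (fun p => k (z, p)).
Proof. exact: (measurableT_comp mk (pair1_measurable z)). Qed.

Let mwz z : measurable_fun setT (fun p => w (z, p)).
Proof. exact: (measurableT_comp mw (pair1_measurable z)). Qed.

Let w_ge0 q : 0 <= w q. Proof. by case/andP: (w01 q). Qed.
Let w_le1 q : w q <= 1. Proof. by case/andP: (w01 q). Qed.

Let iw z : mu.-integrable setT (fun p => (w (z, p))%:E).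
Proof.
apply/integrableP; split; first exact/measurable_EFinP.
rewrite (eq_integral (fun p => (w (z, p))%:E)); last first.
  by move=> p _; rewrite gee0_abs// lee_fin.
exact: le_lt_trans (wr z) (ltry _).
Qed.

Let iF2w z F : square_integrable F ->
  mu.-integrable setT (fun p => (F p ^+ 2 * w (z, p))%:E).
Proof.
move=> sF; apply: (le_integrable_EFin _ _ (square_integrableP sF)) => [|p].
  by apply: measurable_funM => //; apply: measurable_funX; case: sF.
by rewrite normrM (ger0_norm (sqr_ge0 _)) (ger0_norm (w_ge0 _)) ler_piMr ?sqr_ge0.
Qed.

Let iFw z F : square_integrable F ->
  mu.-integrable setT (fun p => (`|F p| * w (z, p))%:E).
Proof.
move=> sF; have iD := integrableD measurableT (square_integrableP sF) (iw z).
apply: (@le_integrable_EFin _ (fun p => F p ^+ 2 + w (z, p))) => [|p|//].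
  by apply: measurable_funM => //; apply: measurableT_comp => //; case: sF.
have := w_ge0 (z, p); have := w_le1 (z, p); have := normr_ge0 (F p).
rewrite normrM normr_id (ger0_norm (w_ge0 _)) -(real_normK (num_real (F p))).
move: `|F p| (w (z, p)) => a b a0 b1 b0.
(* The two inequalities add up to a b <= a^2 + b, valid because b lies in [0, 1]. *)
have h1 : 0 <= a ^+ 2 * (1 - b) by rewrite mulr_ge0 ?sqr_ge0 ?subr_ge0.
have h2 : 0 <= b * ((a - 1) ^+ 2 + a) by rewrite mulr_ge0 ?addr_ge0 ?sqr_ge0.
nra.
Qed.

Lemma integrable_kernel z F : square_integrable F ->
  mu.-integrable setT (fun p => (F p * k (z, p))%:E).
Proof.
move=> sF; have [mF _] := sF.
apply: (@le_integrable_EFin _ (fun p => M * (`|F p| * w (z, p)))) => [|p|].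
- exact: measurable_funM.
- by rewrite normrM mulrCA ler_wpM2l.
- exact: (integrableZl measurableT M (iFw z sF)).
Qed.

Lemma measurable_kernel_op F : measurable_fun setT F ->
  measurable_fun setT (kernel_op k F).
Proof.
move=> mF; apply: measurableT_comp => //.
apply: (@measurable_integral_section _ _ _ _ _ mu (fun q => (F q.2 * k q)%:E)).
apply/measurable_EFinP/measurable_funM => //.
exact: measurableT_comp.
Qed.

(** Exchanging the integrals leaves the integral of [w] in its first variable, which [wl] bounds by
    [V]. *)
Lemma tonelli_weight (h : X -> R) : measurable_fun setT h -> (forall p, 0 <= h p) ->
  (\int[mu]_z \int[mu]_p (h p * w (z, p))%:E <= V%:E * \int[mu]_p (h p)%:E)%E.
Proof.
move=> mh h0.
rewrite (fubini_tonelli (fun q : X * X => (h q.2 * w q)%:E))/=; last 2 first.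
- apply/measurable_EFinP/measurable_funM => //; exact: measurableT_comp.
- by move=> q; rewrite lee_fin mulr_ge0.
rewrite -ge0_integralZl//; last 3 first.
- exact/measurable_EFinP.
- by move=> p _; rewrite lee_fin.
- by rewrite lee_fin ltW.
apply: ge0_le_integral => //.
- by move=> p _; apply: integral_ge0 => z _; rewrite lee_fin mulr_ge0.
- apply: (measurable_fun_fubini_tonelli_G (fun q : X * X => (h q.2 * w q)%:E)).
    apply/measurable_EFinP/measurable_funM => //; exact: measurableT_comp.
  by move=> q; rewrite lee_fin mulr_ge0.
- by apply: measurable_funeM; exact/measurable_EFinP.
move=> p _; under eq_integral do rewrite EFinM.
rewrite ge0_integralZl//; last 3 first.
- by apply/measurable_EFinP; exact: (measurableT_comp mw (pair2_measurable p)).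
- by move=> z _; rewrite lee_fin.
- by rewrite lee_fin.
by rewrite muleC; apply: lee_wpmul2r; rewrite ?lee_fin.
Qed.

Lemma kernel_op_le z F : square_integrable F ->
  `|kernel_op k F z| <= M * \int[mu]_p (`|F p| * w (z, p)).
Proof.
move=> sF; have ik := integrable_kernel z sF.
apply: (le_trans (le_normr_Rintegral measurableT ik)).
rewrite -RintegralZl//; last exact: iFw.
apply: le_Rintegral => //.
- by have := integrable_norm ik.
- by have := integrableZl measurableT M (iFw z sF).
move=> p _; rewrite normrM mulrCA ler_wpM2l//.
Qed.

(** The integral of (|F| - l)^2 w is a nonnegative quadratic polynomial in l. *)
Lemma weight_cauchy_schwarz z F : square_integrable F ->
  (\int[mu]_p (`|F p| * w (z, p))) ^+ 2 <= V * \int[mu]_p (F p ^+ 2 * w (z, p)).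
Proof.
move=> sF; set a := \int[mu]_p _; set A := \int[mu]_p _.
pose v := \int[mu]_p w (z, p).
have vV : v <= V.
  by rewrite -lee_fin /v /Rintegral fineK//; exact: integrable_fin_num (iw z).
have q l : 0 <= A - 2 * l * a + l ^+ 2 * v.
  have : 0 <= \int[mu]_p ((`|F p| - l) ^+ 2 * w (z, p)).
    by apply: Rintegral_ge0 => p _; rewrite mulr_ge0 ?sqr_ge0.
  have -> : (fun p => (`|F p| - l) ^+ 2 * w (z, p)) =
      (fun p => (F p ^+ 2 * w (z, p) - (2 * l) * (`|F p| * w (z, p))) + l ^+ 2 * w (z, p)).
    by apply/funext => p; rewrite -(real_normK (num_real (F p))); ring.
  rewrite RintegralD//; last 2 first.
  - have := integrableB measurableT (iF2w z sF) (integrableZl measurableT (2 * l) (iFw z sF)).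
    by apply: eq_integrable.
  - by have := integrableZl measurableT (l ^+ 2) (iw z); apply: eq_integrable.
  rewrite RintegralB//; last 2 first.
  - exact: iF2w.
  - by have := integrableZl measurableT (2 * l) (iFw z sF); apply: eq_integrable.
  rewrite RintegralZl//; last exact: iFw.
  by rewrite RintegralZl//; exact: iw.
(* The minimizer would be a / v. Using V >= v avoids dividing by a possibly zero v. *)
have := q (a / V); have V1 : V != 0 by rewrite gt_eqF.
have h : (a / V) ^+ 2 * v <= (a / V) ^+ 2 * V by rewrite ler_wpM2l ?sqr_ge0.
move=> h2; have {h h2} : 0 <= A - 2 * (a / V) * a + (a / V) ^+ 2 * V by lra.
have -> : A - 2 * (a / V) * a + (a / V) ^+ 2 * V = A - a ^+ 2 / V by field.
by rewrite subr_ge0 ler_pdivrMr// mulrC.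
Qed.

(** Cauchy-Schwarz in p costs one factor V through the marginal [wr], integration in z costs the
    other through [wl]. *)
Lemma sqnorm_kernel_op F : square_integrable F ->
  (sqnorm (kernel_op k F) <= ((M * V) ^+ 2)%:E * sqnorm F)%E.
Proof.
move=> sF; have [mF _] := sF.
have mF2 : measurable_fun setT (fun p => F p ^+ 2) by exact: measurable_funX.
have F20 p : 0 <= F p ^+ 2 by exact: sqr_ge0.
have mq : measurable_fun setT (fun q : X * X => (F q.2 ^+ 2 * w q)%:E).
  by apply/measurable_EFinP/measurable_funM => //; exact: (measurableT_comp mF2 measurable_snd).
have mS := @measurable_integral_section _ _ _ _ _ mu _ mq.
apply: (@le_trans _ _ (\int[mu]_z ((M ^+ 2 * V)%:E * \int[mu]_p (F p ^+ 2 * w (z, p))%:E))%E).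
  apply: ge0_le_integral => //.
  - by move=> z _; rewrite lee_fin sqr_ge0.
  - by apply/measurable_EFinP/measurable_funX; exact: measurable_kernel_op.
  - exact: (measurable_funeM _ mS).
  move=> z _; have iz := iF2w z sF.
  have -> : (\int[mu]_p (F p ^+ 2 * w (z, p))%:E =
      (\int[mu]_p (F p ^+ 2 * w (z, p)))%:E)%E.
    by rewrite /Rintegral fineK//; exact: integrable_fin_num iz.
  rewrite -EFinM lee_fin -(real_normK (num_real (kernel_op k F z))).
  have h := kernel_op_le z sF; have cs := weight_cauchy_schwarz z sF.
  apply: (@le_trans _ _ ((M * \int[mu]_p (`|F p| * w (z, p))) ^+ 2)).
    by rewrite ler_pXn2r// nnegrE ?(le_trans _ h).
  rewrite exprMn -[leRHS]mulrA; apply: ler_wpM2l => //; exact: sqr_ge0.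
rewrite ge0_integralZl//; last 2 first.
- by move=> z _; apply: integral_ge0 => p _; rewrite lee_fin mulr_ge0.
- by rewrite lee_fin mulr_ge0 ?sqr_ge0 ?ltW.
have -> : (M * V) ^+ 2 = M ^+ 2 * V * V by ring.
rewrite [((_ * V) * V)%:E]EFinM -muleA; apply: lee_wpmul2l.
  by rewrite lee_fin mulr_ge0 ?sqr_ge0 ?ltW.
exact: tonelli_weight.
Qed.

(** Since w <= 1, one of the two factors |F| w of the square integrates to at most A. Only one V is
    spent, and this is the gain over the L2 bound once the kernel is normalized. *)
Lemma sqnorm_kernel_op_L1 F (A : R) : square_integrable F ->
  (\int[mu]_p `|F p|%:E = A%:E)%E ->
  (sqnorm (kernel_op k F) <= (M ^+ 2 * V * A ^+ 2)%:E)%E.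
Proof.
move=> sF FA; have [mF _] := sF.
have mF1 : measurable_fun setT (fun p => `|F p|) by exact: measurableT_comp.
have iF : mu.-integrable setT (fun p => `|F p|%:E).
  apply/integrableP; split; first exact/measurable_EFinP.
  by under eq_integral do rewrite abse_EFin normr_id; rewrite FA ltry.
have A0 : 0 <= A by rewrite -lee_fin -FA; apply: integral_ge0 => p _; rewrite lee_fin.
have mq : measurable_fun setT (fun q : X * X => (`|F q.2| * w q)%:E).
  apply/measurable_EFinP/measurable_funM => //; exact: (measurableT_comp mF1 measurable_snd).
have mS := @measurable_integral_section _ _ _ _ _ mu _ mq.
apply: (@le_trans _ _ (\int[mu]_z ((M ^+ 2 * A)%:E * \int[mu]_p (`|F p| * w (z, p))%:E))%E).
  apply: ge0_le_integral => //.
  - by move=> z _; rewrite lee_fin sqr_ge0.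
  - by apply/measurable_EFinP/measurable_funX; exact: measurable_kernel_op.
  - exact: (measurable_funeM _ mS).
  move=> z _; have iz := iFw z sF.
  set a := \int[mu]_p (`|F p| * w (z, p)).
  have -> : (\int[mu]_p (`|F p| * w (z, p))%:E = a%:E)%E.
    by rewrite /a /Rintegral fineK//; exact: integrable_fin_num iz.
  rewrite -EFinM lee_fin -(real_normK (num_real (kernel_op k F z))).
  have h : `|kernel_op k F z| <= M * a := kernel_op_le z sF.
  have a0 : 0 <= a by apply: Rintegral_ge0 => p _; rewrite mulr_ge0.
  have aA : a <= A.
    rewrite (_ : A = \int[mu]_p `|F p|); last by rewrite /Rintegral FA.
    by apply: le_Rintegral => // p _; rewrite ler_piMr.
  apply: (@le_trans _ _ ((M * a) ^+ 2)).
    by rewrite ler_pXn2r// nnegrE ?(le_trans _ h).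
  rewrite exprMn -[leRHS]mulrA; apply: ler_wpM2l; first exact: sqr_ge0.
  by rewrite expr2; exact: ler_wpM2r.
rewrite ge0_integralZl//; last 2 first.
- by move=> z _; apply: integral_ge0 => p _; rewrite lee_fin mulr_ge0.
- by rewrite lee_fin mulr_ge0 ?sqr_ge0.
have -> : M ^+ 2 * V * A ^+ 2 = M ^+ 2 * A * (V * A) by ring.
rewrite [((_ * A) * _)%:E]EFinM; apply: lee_wpmul2l.
  by rewrite lee_fin mulr_ge0 ?sqr_ge0.
by rewrite EFinM -FA; exact: tonelli_weight.
Qed.

Lemma kernel_op_lin (c : R) F G z : square_integrable F -> square_integrable G ->
  kernel_op k (fun x => c * F x + G x) z = c * kernel_op k F z + kernel_op k G z.
Proof.
move=> sF sG; have iF := integrable_kernel z sF; have iG := integrable_kernel z sG.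
rewrite /kernel_op -RintegralZl// -RintegralD//.
  by congr Rintegral; apply/funext => p; rewrite mulrDl mulrA.
exact: (integrableZl measurableT c iF).
Qed.

End Schur.

(** * Approximation in L2 *)

Section SquareIntegrable.
Context d (X : measurableType d) (R : realType).
Variable mu : {sigma_finite_measure set X -> \bar R}.
Implicit Types (F G H : X -> R).
Local Notation sqnorm := (sqnorm mu).
Local Notation L2 := (square_integrable mu).

Lemma measurable_sq F : measurable_fun setT F ->
  measurable_fun setT (fun x => ((F x) ^+ 2)%:E).
Proof. by move=> mF; apply/measurable_EFinP; exact: measurable_funX. Qed.

Lemma sqnormZ (c : R) F : measurable_fun setT F ->
  sqnorm (fun x => c * F x) = ((c ^+ 2)%:E * sqnorm F)%E.
Proof.
move=> mF; rewrite /sqnorm; under eq_integral do rewrite exprMn EFinM.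
rewrite ge0_integralZl//.
- exact: measurable_sq.
- by move=> x _; rewrite lee_fin sqr_ge0.
- by rewrite lee_fin sqr_ge0.
Qed.

Lemma sqnormD F G : measurable_fun setT F -> measurable_fun setT G ->
  (sqnorm (fun x => F x + G x)%R <= 2%:E * (sqnorm F + sqnorm G))%E.
Proof.
move=> mF mG; rewrite /sqnorm -ge0_integralD//; last 4 first.
- by move=> x _; rewrite lee_fin sqr_ge0.
- exact: measurable_sq.
- by move=> x _; rewrite lee_fin sqr_ge0.
- exact: measurable_sq.
rewrite -ge0_integralZl//; last 2 first.
- by apply: emeasurable_funD; exact: measurable_sq.
- by move=> x _; rewrite adde_ge0// lee_fin sqr_ge0.
apply: ge0_le_integral => //.
- by move=> x _; rewrite lee_fin sqr_ge0.
- by apply: measurable_sq; exact: measurable_funD.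
- by apply: measurable_funeM; apply: emeasurable_funD; exact: measurable_sq.
move=> x _; rewrite -EFinD -EFinM lee_fin.
have := sqr_ge0 (F x - G x); nra.
Qed.

Lemma L2_lin (c : R) F G : L2 F -> L2 G -> L2 (fun x => c * F x + G x).
Proof.
move=> [mF F2] [mG G2].
have mcF : measurable_fun setT (fun x => c * F x) by exact: measurable_funM.
split; first exact: measurable_funD.
apply: le_lt_trans (sqnormD mcF mG) _.
rewrite lte_mul_pinfty// sqnormZ// lte_add_pinfty// lte_mul_pinfty//.
by rewrite lee_fin sqr_ge0.
Qed.

Lemma L2_le F G : L2 G -> measurable_fun setT F -> (forall x, `|F x| <= G x) -> L2 F.
Proof.
move=> [mG G2] mF FG; split=> //; apply: le_lt_trans G2; apply: sqnorm_le => // x.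
have h := FG x; rewrite -(real_normK (num_real (F x))).
by rewrite ler_pXn2r// nnegrE (le_trans _ h).
Qed.

(** Dominated convergence for the squared differences, with the integrable majorant 4 H^2. *)
Lemma L2_dominated_cvg (F_ : nat -> X -> R) F H : L2 H ->
  (forall m, measurable_fun setT (F_ m)) -> measurable_fun setT F ->
  (forall m x, `|F_ m x| <= H x) -> (forall x, `|F x| <= H x) ->
  {ae mu, forall x, F_ m x @[m --> \oo] --> F x} ->
  forall e : R, 0 < e -> \forall m \near \oo, (sqnorm (fun x => F_ m x - F x)%R <= e%:E)%E.
Proof.
move=> [mH H2] mF_ mF FH_ FH cvF e e0.
have mD m : measurable_fun setT (fun x => F_ m x - F x) by exact: measurable_funB.
have iH : mu.-integrable setT (fun x => (4 * H x ^+ 2)%:E).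
  have := integrableZl measurableT 4 (square_integrableP (conj mH H2)).
  by apply: eq_integrable.
have aecv : {ae mu, forall x, setT x -> ((F_ m x - F x) ^+ 2)%:E @[m --> \oo] --> 0%E}.
  apply: filterS cvF => x cx _; apply: cvg_EFin; first exact: nearW.
  have cd : (F_ m x - F x) @[m --> \oo] --> 0.
    by rewrite -(subrr (F x)); apply: cvgB => //; exact: cvg_cst.
  rewrite (_ : 0 = 0 * 0 :> R); last by rewrite mul0r.
  by under eq_fun do rewrite expr2; exact: cvgM.
have aebd : {ae mu, forall x m, setT x -> (`|((F_ m x - F x) ^+ 2)%:E| <= (4 * H x ^+ 2)%:E)%E}.
  apply: aeW => x m _; rewrite abse_EFin lee_fin ger0_norm ?sqr_ge0//.
  have h1 := FH_ m x; have h2 := FH x.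
  rewrite -(real_normK (num_real (_ - _))).
  have h3 : `|F_ m x - F x| <= 2 * H x by apply: le_trans (ler_normB _ _) _; lra.
  rewrite (_ : 4 * H x ^+ 2 = (2 * H x) ^+ 2); last by ring.
  by rewrite ler_pXn2r// nnegrE (le_trans _ h3).
have [_ _] := @dominated_convergence _ _ _ mu setT measurableT
  (fun m x => ((F_ m x - F x) ^+ 2)%:E) (cst 0%E) (fun x => (4 * H x ^+ 2)%:E)
  (fun m => measurable_sq (mD m)) (measurable_cst _) aecv iH aebd.
rewrite integral0 => /fine_cvgP[nf /cvgr0Pnorm_le/(_ e e0) nl].
near=> m.
have fm : (sqnorm (fun x => F_ m x - F x)%R) \is a fin_num by near: m; exact: nf.
rewrite -(fineK fm) lee_fin; apply: le_trans (ler_norm _) _.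
near: m; exact: nl.
Unshelve. all: by end_near. Qed.

Lemma L2_indic (B : set X) : measurable B -> (mu B < +oo)%E -> L2 (\1_B).
Proof.
move=> mB Boo; split; first exact: measurable_indic.
rewrite /sqnorm (eq_integral (fun x => (\1_B x)%:E)).
  by rewrite integral_indic// setIT.
by move=> x _; rewrite indicE; case: (x \in B); rewrite ?expr1n ?expr0n.
Qed.

Lemma sqnorm0 : sqnorm (fun=> 0) = 0%E.
Proof. by rewrite /sqnorm; under eq_integral do rewrite expr0n /=; rewrite integral0. Qed.

Lemma L2_0 : L2 (fun=> 0).
Proof. by split; [exact: measurable_cst|rewrite sqnorm0 ltry]. Qed.

Variables (A : nat -> (X -> R) -> X -> R) (C : R).
Hypothesis C0 : 0 <= C.
Hypothesis A_meas : forall m F, L2 F -> measurable_fun setT (A m F).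
Hypothesis A_lin : forall m c F G, L2 F -> L2 G ->
  A m (fun x => c * F x + G x) = (fun x => c * A m F x + A m G x).
Hypothesis A_bd : forall m F, L2 F -> (sqnorm (A m F) <= C%:E * sqnorm F)%E.

(** Strong convergence of the operators [A m] at [F]. The functions with this property form a closed
    subspace of L2, which is then filled starting from indicators. *)
Definition approximated F := forall e : R, 0 < e ->
  \forall m \near \oo, (sqnorm (fun x => A m F x - F x)%R <= e%:E)%E.

Lemma approximated_lin c F G : L2 F -> L2 G -> approximated F -> approximated G ->
  approximated (fun x => c * F x + G x).
Proof.
move=> sF sG aF aG e e0.
have c1 : 0 < c ^+ 2 + 1 by rewrite ltr_wpDl ?sqr_ge0.
(* Chosen so that 2 (c^2 e / (4 (c^2 + 1)) + e / 4) <= e; the added 1 covers c = 0. *)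
have e1 : 0 < e / (4 * (c ^+ 2 + 1)) by rewrite divr_gt0// mulr_gt0.
have e2 : 0 < e / 4 by rewrite divr_gt0.
near=> m.
have hF : (sqnorm (fun x => A m F x - F x)%R <= (e / (4 * (c ^+ 2 + 1)))%:E)%E.
  by near: m; exact: aF.
have hG : (sqnorm (fun x => A m G x - G x)%R <= (e / 4)%:E)%E by near: m; exact: aG.
have mF : measurable_fun setT (fun x => A m F x - F x).
  by apply: measurable_funB; [exact: A_meas|case: sF].
have mG : measurable_fun setT (fun x => A m G x - G x).
  by apply: measurable_funB; [exact: A_meas|case: sG].
rewrite (_ : (fun x => _) = (fun x => c * (A m F x - F x) + (A m G x - G x))); last first.
  by apply/funext => x; rewrite A_lin//; ring.
apply: le_trans (sqnormD _ mG) _; first exact: measurable_funM.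
rewrite sqnormZ//.
apply: (@le_trans _ _ (2%:E * ((c ^+ 2)%:E * (e / (4 * (c ^+ 2 + 1)))%:E + (e / 4)%:E))%E).
  apply: lee_wpmul2l => //; apply: leeD => //; apply: lee_wpmul2l => //.
  by rewrite lee_fin sqr_ge0.
rewrite -!(EFinM, EFinD) lee_fin.
have c2 : c ^+ 2 / (c ^+ 2 + 1) <= 1 by rewrite ler_pdivrMr// mul1r lerDl.
have -> : 2 * (c ^+ 2 * (e / (4 * (c ^+ 2 + 1))) + e / 4) =
  e / 2 * (c ^+ 2 / (c ^+ 2 + 1)) + e / 2 by field; rewrite gt_eqF.
by nra.
Unshelve. all: by end_near. Qed.

(** A F - F equals (A G - G) + A (F - G) - (F - G), and the bound [C], uniform in m, makes the last
    two terms as small as F - G. *)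
Lemma approximated_closed F : L2 F ->
  (forall e : R, 0 < e -> exists G, [/\ L2 G, approximated G &
     (sqnorm (fun x => F x - G x)%R <= e%:E)%E]) -> approximated F.
Proof.
move=> sF h e e0.
have K0 : 0 < 8 * (C + 1) by rewrite mulr_gt0// ltr_wpDl.
(* The last two terms together contribute 2 (C + 1) e / (8 (C + 1)) = e / 4. *)
have e1 : 0 < e / (8 * (C + 1)) by rewrite divr_gt0.
have e2 : 0 < e / 4 by rewrite divr_gt0.
have [G [sG aG FG]] := h _ e1.
near=> m.
have hG : (sqnorm (fun x => A m G x - G x)%R <= (e / 4)%:E)%E by near: m; exact: aG.
have sD : L2 (fun x => -1 * G x + F x) by exact: L2_lin.
have mD : measurable_fun setT (fun x => A m G x - G x).
  by apply: measurable_funB; [exact: A_meas|case: sG].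
have DE : (fun x => -1 * G x + F x) = (fun x => F x - G x).
  by apply/funext => x; ring.
have mA := A_meas m sD.
have mH : measurable_fun setT (fun x => A m (fun x => -1 * G x + F x) x + (-1) * (-1 * G x + F x)).
  by apply: measurable_funD => //; apply: measurable_funM => //; case: sD.
rewrite (_ : (fun x => A m F x - F x) = (fun x => (A m G x - G x) +
   (A m (fun x => -1 * G x + F x) x + (-1) * (-1 * G x + F x)))); last first.
  by apply/funext => x; rewrite A_lin//; ring.
apply: le_trans (sqnormD mD mH) _.
have hb : (sqnorm (fun x => A m (fun x => -1 * G x + F x) x + (-1) * (-1 * G x + F x))%R <=
    (e / 4)%:E)%E.
  have mN : measurable_fun setT (fun x => (-1) * (-1 * G x + F x)).
    by apply: measurable_funM => //; case: sD.
  apply: le_trans (sqnormD mA mN) _.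
  rewrite sqnormZ; last by case: sD.
  apply: (@le_trans _ _ (2%:E * (C%:E * (e / (8 * (C + 1)))%:E + (e / (8 * (C + 1)))%:E))%E).
    apply: lee_wpmul2l => //; apply: leeD.
      by apply: le_trans (A_bd m sD) _; rewrite DE; apply: lee_wpmul2l.
    by rewrite sqrrN expr1n mul1e DE.
  rewrite -!(EFinM, EFinD) lee_fin.
  rewrite (_ : 2 * _ = e / 4)//; field; apply: lt0r_neq0; lra.
apply: (@le_trans _ _ (2%:E * ((e / 4)%:E + (e / 4)%:E))%E).
  by apply: lee_wpmul2l => //; exact: leeD.
by rewrite -!(EFinM, EFinD) lee_fin; lra.
Unshelve. all: by end_near. Qed.

Lemma approximated0 : approximated (fun=> 0).
Proof.
move=> e e0; apply: nearW => m.
under eq_fun do rewrite subr0.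
by apply: le_trans (A_bd m L2_0) _; rewrite sqnorm0 mule0 lee_fin ltW.
Qed.

Lemma approximated_sum (I : Type) (r : seq I) (c : I -> R) (F : I -> X -> R) :
  (forall i, L2 (F i)) -> (forall i, approximated (F i)) ->
  L2 (fun x => \sum_(i <- r) c i * F i x) /\ approximated (fun x => \sum_(i <- r) c i * F i x).
Proof.
move=> sF aF; elim: r => [|i r [IHs IHa]].
  under eq_fun do rewrite big_nil; split; [exact: L2_0|exact: approximated0].
under eq_fun do rewrite big_cons.
by split; [exact: L2_lin|exact: approximated_lin].
Qed.

(** The sets [E m] localize to finite measure, since generators and complements need not have square
    integrable indicators. *)
Variables (E : nat -> set X) (Gen : set (set X)).
Hypothesis mE : forall m, measurable (E m).
Hypothesis Eoo : forall m, (mu (E m) < +oo)%E.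
Hypothesis ndE : forall x, \forall m \near \oo, E m x.
Hypothesis GenE : @measurable _ X = <<s Gen >>.
Hypothesis GenI : setI_closed Gen.
Hypothesis approx_gen : forall m B, Gen B -> approximated (\1_(B `&` E m)).
Hypothesis approx_E : forall m, approximated (\1_(E m)).

Let L2_indicE m B : measurable B -> L2 (\1_(B `&` E m)).
Proof.
move=> mB; apply: L2_indic; first exact: measurableI.
apply: le_lt_trans (Eoo m); apply: le_measure; rewrite ?inE//; exact: measurableI.
Qed.

(** Dynkin's theorem inside [E m]: complements by subtraction from the indicator of [E m], disjoint
    unions as L2 limits of partial sums dominated by that indicator. *)
Lemma approximated_indic m B : measurable B -> approximated (\1_(B `&` E m)).
Proof.
move=> mB; have : <<s Gen >> B by rewrite -GenE.
move: B {mB}; apply: (dynkin_induction GenE GenI).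
- by rewrite setTI.
- exact: approx_gen.
- move=> S mS aS.
  rewrite (_ : \1_(~` S `&` E m) = (fun x => -1 * \1_(S `&` E m) x + \1_(E m) x :> R)).
    apply: approximated_lin => //; first exact: L2_indicE.
    exact: L2_indic.
  apply/funext => x; rewrite !indicE !in_setI in_setC.
  by case: (x \in S); case: (x \in E m); rewrite /=; ring.
- move=> F mF tF aF.
  have mU : measurable (\bigcup_k F k) by exact: bigcupT_measurable.
  apply: approximated_closed; first exact: L2_indicE.
  move=> e e0.
  pose G (k : nat) := fun x => \sum_(i <- iota 0 k) 1 * \1_(F i `&` E m) x : R.
  have GE k : G k = \1_((\big[setU/set0]_(i < k) F i) `&` E m).
    apply/funext => x; rewrite /G; elim: k => [|k IH].
      by rewrite big_nil big_ord0 set0I indic0.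
    rewrite -addn1 iotaD big_cat IH /= big_seq1 mul1r addn1 big_ord_recr /=.
    rewrite !indicE !in_setI in_setU; case: (boolP (x \in F k)) => [|_]; last first.
      by rewrite orbF /= addr0.
    rewrite inE => xk.
    rewrite (_ : (x \in \big[setU/set0]_(i < k) F i) = false) ?add0r//.
    apply/negbTE; rewrite notin_setE -bigcup_mkord => -[i /= ik Fi].
    have /trivIsetP/(_ i k I I) := tF; rewrite ltn_eqF// => /(_ isT)/seteqP[+ _].
    by move=> /(_ x); apply.
  have sa k : L2 (G k) /\ approximated (G k).
    by apply: approximated_sum => i; [exact: L2_indicE|exact: aF].
  have sE : L2 (\1_(E m)) by exact: L2_indic.
  have : \forall k \near \oo, (sqnorm (fun x => G k x - \1_(\bigcup_k F k `&` E m) x)%R <= e%:E)%E.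
    apply: (L2_dominated_cvg sE) => //.
    + by move=> k; case: (sa k) => -[].
    + by case: (L2_indicE m mU).
    + move=> k x; rewrite GE !indicE in_setI; case: (x \in E m); rewrite ?andbT ?andbF ?normr0//.
      by case: (_ \in _); rewrite ?normr1 ?normr0.
    + move=> x; rewrite !indicE in_setI; case: (x \in E m); rewrite ?andbT ?andbF ?normr0//.
      by case: (_ \in _); rewrite ?normr1 ?normr0.
    apply: aeW => x; apply: cvg_near_cst.
    have [[i _ Fi]|nF] := pselect ((\bigcup_k F k) x).
      near=> k; rewrite GE !indicE !in_setI; congr (nat_of_bool (_ && _))%:R.
      rewrite [RHS]mem_set; last by exists i.
      apply: mem_set; rewrite -bigcup_mkord; exists i => //=.
      by near: k; exact: nbhs_infty_gt.
    near=> k; rewrite GE !indicE !in_setI; congr (nat_of_bool (_ && _))%:R.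
    rewrite [RHS]memNset//; apply: memNset.
    by rewrite -bigcup_mkord => -[i _ Fi]; apply: nF; exists i.
  move=> [k _ /(_ k (leqnn k)) hk].
  exists (G k); case: (sa k) => ? ?; split => //.
  apply: le_trans hk; apply: sqnorm_le.
  + by apply: measurable_funB; [case: (L2_indicE m mU)|case: (sa k) => -[]].
  + by apply: measurable_funB; [case: (sa k) => -[]|case: (L2_indicE m mU)].
  + by move=> x; rewrite -sqrrN opprB.
Unshelve. all: by end_near. Qed.

Import HBNNSimple.

(** Simple functions increasing to F, cut off by [E m], are dominated by F and hence converge to it
    in L2. *)
Lemma approximated_ge0 F : L2 F -> (forall x, 0 <= F x) -> approximated F.
Proof.
move=> sF F0; have [mF _] := sF.
have mEF : measurable_fun setT (EFin \o F) by exact/measurable_EFinP.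
pose h := nnsfun_approx measurableT mEF.
pose G m := fun x => h m x * \1_(E m) x.
have sa m : L2 (G m) /\ approximated (G m).
  pose s := finmap.enum_fset (fset_set (h m @` setT)).
  have -> : G m = fun x => \sum_(y <- s) y * \1_(h m @^-1` [set y] `&` E m) x.
    apply/funext => x; rewrite /G fimfunE fsbig_finite//= mulr_suml; apply: eq_bigr => y _.
    by rewrite -mulrA; congr (_ * _); rewrite indicI.
  apply: approximated_sum => y.
    by apply: L2_indicE; exact: measurable_sfunP.
  by apply: approximated_indic; exact: measurable_sfunP.
have ch x : h m x @[m --> \oo] --> F x.
  have := @cvg_nnsfun_approx _ _ _ _ measurableT _ mEF (fun y _ => F0 y) x I.
  by move/fine_cvgP => [].
have hF m x : h m x <= F x.
  have nd : nondecreasing_seq (fun k => h k x).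
    by move=> a b ab; exact/lefP/(nd_nnsfun_approx measurableT mEF ab).
  rewrite -(cvg_lim _ (ch x))//; apply: (nondecreasing_cvgn_le nd).
  by apply/cvg_ex; exists (F x); exact: ch.
have G0 m x : 0 <= G m x by rewrite /G mulr_ge0// indicE.
have GF m x : G m x <= F x.
  rewrite /G indicE; case: (x \in E m); rewrite ?mulr1 ?mulr0//.
apply: approximated_closed => // e e0.
have : \forall k \near \oo, (sqnorm (fun x => G k x - F x)%R <= e%:E)%E.
  apply: (L2_dominated_cvg sF) => //.
  - by move=> m; case: (sa m) => -[].
  - by move=> m x; rewrite ger0_norm.
  - by move=> x; rewrite ger0_norm.
  apply: aeW => x.
  apply: cvg_trans (ch x); apply: near_eq_cvg; near=> m.
  rewrite /G indicE mem_set ?mulr1//.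
  by near: m; exact: ndE.
move=> [k _ /(_ k (leqnn k)) hk].
exists (G k); case: (sa k) => ? ?; split => //.
apply: le_trans hk; apply: sqnorm_le.
- by apply: measurable_funB => //; case: (sa k) => -[].
- by apply: measurable_funB => //; case: (sa k) => -[].
- by move=> x; rewrite -sqrrN opprB.
Unshelve. all: by end_near. Qed.

Lemma approximated_L2 F : L2 F -> approximated F.
Proof.
move=> sF; have [mF _] := sF.
have sN : L2 (fun x => `|F x|).
  split; first exact: measurableT_comp.
  case: sF => _; rewrite /sqnorm; congr (_ < _)%E; apply: eq_integral => x _.
  by rewrite real_normK ?num_real.
have mp : measurable_fun setT (fun x => Num.max (F x) 0) by exact: measurable_maxr.
have mn : measurable_fun setT (fun x => Num.max (- F x) 0).
  by apply: measurable_maxr => //; exact: measurableT_comp.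
have p0 x : 0 <= Num.max (F x) 0 by rewrite le_max lexx orbT.
have n0 x : 0 <= Num.max (- F x) 0 by rewrite le_max lexx orbT.
have sp : L2 (fun x => Num.max (F x) 0).
  apply: (L2_le sN) => // x; rewrite ger0_norm//.
  by rewrite ge_max ler_norm normr_ge0.
have sn : L2 (fun x => Num.max (- F x) 0).
  apply: (L2_le sN) => // x; rewrite ger0_norm//.
  by rewrite ge_max normr_ge0 andbT -normrN ler_norm.
rewrite (_ : F = fun x => -1 * Num.max (- F x) 0 + Num.max (F x) 0).
  by apply: approximated_lin => //; exact: approximated_ge0.
apply/funext => x; have [Fx|Fx] := leP (F x) 0; case: leP => Fx'; lra.
Qed.

End SquareIntegrable.

(** * Averaging operators and their uniform bounds *)

Section Averages.
Variables (R : realType) (n : nat).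
Local Notation N := (2 * n).+1.
Local Notation T := (N.-tuple R).
Local Notation mu := (leb R N).
Local Notation sqnorm := (sqnorm mu).
Local Notation L2 := (square_integrable mu).
Implicit Types (r : R) (z p : T) (g : 'I_N -> R -> R) (F : T -> R).

Definition kop g r F : T -> R := kernel_op mu (fun q => kprod g r q.1 q.2) F.

Lemma good_measurable g : good_factors g -> forall j, measurable_fun setT (g j).
Proof.
by move=> gg j; apply: continuous_measurable_fun; apply: smooth1_continuous; case: (gg j).
Qed.

(** The dilation acts on the arguments of the factors only, so the product of their suprema bounds
    the kernel at every scale r with the same M. *)
Lemma kernel_bound g : good_factors g ->
  exists2 M : R, 0 <= M & forall r, 0 < r -> forall q : T * T,
    `|kprod g r q.1 q.2| <= M * kboth r q.1 q.2.
Proof.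
move=> gg.
have /choice[B hB] j : exists M, 0 <= M /\ forall x, `|g j x| <= M.
  by have [s0 s1] := gg j; have [M M0 hM] := smooth1_bounded s0 s1; exists M.
exists (\prod_j B j); first by apply: prodr_ge0 => j _; case: (hB j).
move=> r r0 [z p] /=; have gs k : supp01 (g k) by case: (gg k).
have [->|h] := eqVneq (kprod g r z p) 0.
  rewrite normr0 mulr_ge0//; last by case/andP: (kboth01 r z p).
  by apply: prodr_ge0 => j _; case: (hB j).
rewrite (kprod_kboth r0 gs h) mulr1 /kprod /prodf normr_prod.
by apply: ler_prod => j _; rewrite normr_ge0 /=; case: (hB j).
Qed.

Lemma kboth_r r z : 0 < r -> (\int[mu]_p (kboth r z p)%:E <= (kvol n r)%:E)%E.
Proof.
move=> r0; rewrite -(integral_kball z r0); apply: ge0_le_integral => //.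
- by move=> p _; rewrite lee_fin; case/andP: (kboth01 r z p).
- apply/measurable_EFinP.
  exact: (measurableT_comp (@measurable_kboth R n r) (pair1_measurable z)).
- apply/measurable_EFinP.
  exact: (measurableT_comp (@measurable_kball R n r) (pair1_measurable z)).
- by move=> p _; rewrite lee_fin /kboth ler_piMr ?kball_ge0 ?kball_le1.
Qed.

Lemma kboth_l r p : 0 < r -> (\int[mu]_z (kboth r z p)%:E <= (kvol n r)%:E)%E.
Proof.
move=> r0; rewrite (eq_integral (fun z => (kboth r p z)%:E)); first exact: kboth_r.
by move=> z _; rewrite /kboth mulrC.
Qed.

Lemma kvol_gt0 r : 0 < r -> 0 < kvol n r.
Proof. by move=> r0; rewrite mulr_gt0 ?exprn_gt0. Qed.

Section Bounds.
Variables (g : 'I_N -> R -> R) (M r : R).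
Hypothesis gg : good_factors g.
Hypothesis r0 : 0 < r.
Hypothesis gM : forall q : T * T, `|kprod g r q.1 q.2| <= M * kboth r q.1 q.2.

Let mk : measurable_fun setT (fun q : T * T => kprod g r q.1 q.2).
Proof. exact: (measurable_kprod r (good_measurable gg)). Qed.

Let w01 (q : T * T) : 0 <= kboth r q.1 q.2 <= 1. Proof. exact: kboth01. Qed.

Lemma integrable_kop z F : L2 F -> mu.-integrable setT (fun p => (F p * kprod g r z p)%:E).
Proof.
move=> sF.
exact: (@integrable_kernel _ _ _ mu (fun q => kprod g r q.1 q.2) (fun q => kboth r q.1 q.2)
  M (kvol n r) mk (@measurable_kboth R n r) w01 gM (fun z => kboth_r z r0) z F sF).
Qed.

Lemma measurable_kop F : measurable_fun setT F -> measurable_fun setT (kop g r F).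
Proof. by move=> mF; exact: (measurable_kernel_op mu mk mF). Qed.

Lemma kop_lin (c : R) F G z : L2 F -> L2 G ->
  kop g r (fun x => c * F x + G x) z = c * kop g r F z + kop g r G z.
Proof.
move=> sF sG.
exact: (@kernel_op_lin _ _ _ mu (fun q => kprod g r q.1 q.2) (fun q => kboth r q.1 q.2)
  M (kvol n r) mk (@measurable_kboth R n r) w01 gM (fun z => kboth_r z r0) c F G z sF sG).
Qed.

Lemma kop_le z F : L2 F -> `|kop g r F z| <= M * \int[mu]_p (`|F p| * kboth r z p).
Proof.
move=> sF.
exact: (@kernel_op_le _ _ _ mu (fun q => kprod g r q.1 q.2) (fun q => kboth r q.1 q.2)
  M (kvol n r) mk (@measurable_kboth R n r) w01 gM (fun z => kboth_r z r0) z F sF).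
Qed.

Lemma sqnorm_kop F : L2 F -> (sqnorm (kop g r F) <= ((M * kvol n r) ^+ 2)%:E * sqnorm F)%E.
Proof.
move=> sF.
exact: (@sqnorm_kernel_op _ _ _ mu (fun q => kprod g r q.1 q.2) (fun q => kboth r q.1 q.2)
  M (kvol n r) mk (@measurable_kboth R n r) w01 (kvol_gt0 r0) gM
  (fun z => kboth_r z r0) (fun z => kboth_l z r0) F sF).
Qed.

Lemma sqnorm_kop_L1 F (A : R) : L2 F -> (\int[mu]_p `|F p|%:E = A%:E)%E ->
  (sqnorm (kop g r F) <= (M ^+ 2 * kvol n r * A ^+ 2)%:E)%E.
Proof.
move=> sF FA.
exact: (@sqnorm_kernel_op_L1 _ _ _ mu (fun q => kprod g r q.1 q.2) (fun q => kboth r q.1 q.2)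
  M (kvol n r) mk (@measurable_kboth R n r) w01 (kvol_gt0 r0) gM
  (fun z => kboth_r z r0) (fun z => kboth_l z r0) F A sF FA).
Qed.

End Bounds.

Definition bumps : 'I_N -> R -> R := fun=> @smooth_bump R.

Lemma good_bumps : good_factors bumps.
Proof. by move=> j; split; [exact: smooth1_bump|exact: supp01_bump]. Qed.

Lemma integral_bumps r z : 0 < r ->
  mu.-integrable setT (fun p => (kprod bumps r z p)%:E) /\
  \int[mu]_p kprod bumps r z p = r ^+ (2 + 4 * n).
Proof.
move=> r0; have [M M0 hM] := kernel_bound good_bumps.
have mk := measurable_kprod2 r z (good_measurable good_bumps).
have ib : mu.-integrable setT (EFin \o (fun p => M * kball r z p)).
  have ikb : mu.-integrable setT (fun p => (kball r z p)%:E).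
    apply/integrableP; split.
      apply/measurable_EFinP.
      exact: (measurableT_comp (@measurable_kball R n r) (pair1_measurable z)).
    rewrite (eq_integral (fun p => (kball r z p)%:E)).
      by rewrite integral_kball// ltry.
    by move=> p _; rewrite gee0_abs// lee_fin kball_ge0.
  exact: (integrableZl measurableT M ikb).
have ik : mu.-integrable setT (EFin \o kprod bumps r z).
  apply: (le_integrable_EFin mk _ ib) => p.
  apply: le_trans (hM r r0 (z, p)) _; rewrite ler_wpM2l// /kboth.
  by rewrite ler_piMr ?kball_ge0 ?kball_le1.
split; first exact: ik.
rewrite /Rintegral -leb_integrable//.
rewrite (@itint_kprod _ _ r z bumps (fun=> 1))//; last first.
  by move=> j; exact: has_mass_bump.
by rewrite big1 ?mulr1.
Qed.

Definition avg r F : T -> R := fun z => (r ^+ (2 + 4 * n))^-1 * kop bumps r F z.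

(** The normalized kernel has mass one. Used near a point off the faces of a box, and with c = 0 far
    away from the box. *)
Lemma avg_cst r F (c : R) z : 0 < r ->
  (forall p, kprod bumps r z p != 0 -> F p = c) -> avg r F z = c.
Proof.
move=> r0 Fc; have [ib Ib] := integral_bumps z r0.
rewrite /avg /kop /kernel_op.
have -> : \int[mu]_p (F p * kprod bumps r z p) = \int[mu]_p (c * kprod bumps r z p).
  congr Rintegral; apply/funext => p.
  by have [->|/Fc ->//] := eqVneq (kprod bumps r z p) 0; rewrite !mulr0.
rewrite RintegralZl// Ib mulrCA mulVf ?mulr1//.
by rewrite expf_neq0// gt_eqF.
Qed.

(** One constant serves all scales because [kvol n r] is r^Q times 2^N. In the L2 bound the
    normalization cancels both volumes; in the L1 bound only one is present, which leaves r^-Q. The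
    sup bound provides the majorant for averages of boxes. *)
Lemma avg_bound : exists2 C : R, 0 <= C & forall r, 0 < r ->
  [/\ forall F, L2 F -> measurable_fun setT (avg r F),
      forall c F G, L2 F -> L2 G ->
        avg r (fun x => c * F x + G x) = (fun x => c * avg r F x + avg r G x),
      forall F, L2 F -> (sqnorm (avg r F) <= C%:E * sqnorm F)%E,
      forall F (A : R), L2 F -> (\int[mu]_p `|F p|%:E = A%:E)%E ->
        (sqnorm (avg r F) <= (C / r ^+ (2 + 4 * n) * A ^+ 2)%:E)%E &
      forall F z, L2 F -> (forall x, `|F x| <= 1) -> `|avg r F z| <= C + 1].
Proof.
have [M M0 hM] := kernel_bound good_bumps.
exists (M ^+ 2 * (2 ^+ N) ^+ 2); first by rewrite mulr_ge0 ?sqr_ge0.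
move=> r r0; set rQ := r ^+ (2 + 4 * n).
have rQ0 : 0 < rQ by rewrite exprn_gt0.
have rQ0' : rQ != 0 by rewrite gt_eqF.
have mk F : L2 F -> measurable_fun setT (kop bumps r F).
  by case=> mF _; apply: measurable_kop => //; exact: good_bumps.
have vE : kvol n r = rQ * 2 ^+ N by [].
have P0 : 1 <= 2 ^+ N :> R by rewrite exprn_ege1// ler1n.
split.
- by move=> F sF; apply: measurable_funM => //; exact: mk.
- move=> c F G sF sG; apply/funext => x.
  by rewrite /avg (kop_lin good_bumps r0 (hM r r0))//; ring.
- move=> F sF; rewrite sqnormZ; last exact: mk.
  apply: (@le_trans _ _ ((rQ^-1 ^+ 2)%:E * (((M * kvol n r) ^+ 2)%:E * sqnorm F))%E).
    apply: lee_wpmul2l; first by rewrite lee_fin sqr_ge0.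
    exact: sqnorm_kop good_bumps r0 (hM r r0) _ sF.
  rewrite muleA -EFinM vE (_ : rQ^-1 ^+ 2 * _ = M ^+ 2 * (2 ^+ N) ^+ 2)//.
  by field.
- move=> F A sF FA; rewrite sqnormZ; last exact: mk.
  apply: (@le_trans _ _ ((rQ^-1 ^+ 2)%:E * (M ^+ 2 * kvol n r * A ^+ 2)%:E)%E).
    apply: lee_wpmul2l; first by rewrite lee_fin sqr_ge0.
    exact: sqnorm_kop_L1 good_bumps r0 (hM r r0) _ _ sF FA.
  rewrite -EFinM lee_fin vE.
  have -> : rQ^-1 ^+ 2 * (M ^+ 2 * (rQ * 2 ^+ N) * A ^+ 2) = (M ^+ 2 * A ^+ 2 / rQ) * 2 ^+ N.
    by field.
  have -> : M ^+ 2 * (2 ^+ N) ^+ 2 / rQ * A ^+ 2 = (M ^+ 2 * A ^+ 2 / rQ) * (2 ^+ N) ^+ 2.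
    by field.
  apply: ler_wpM2l; last by rewrite expr2 ler_peMl// (le_trans ler01).
  by apply: divr_ge0; [rewrite mulr_ge0 ?sqr_ge0|exact: ltW].
- move=> F z sF F1; rewrite /avg normrM ger0_norm; last by rewrite invr_ge0 ltW.
  rewrite ler_pdivrMl//.
  apply: le_trans (kop_le good_bumps r0 (hM r r0) z sF) _.
  have iw : mu.-integrable setT (EFin \o kboth r z).
    apply/integrableP; split.
      apply/measurable_EFinP.
      exact: (measurableT_comp (@measurable_kboth R n r) (pair1_measurable z)).
    rewrite (eq_integral (fun p => (kboth r z p)%:E)).
      by apply: le_lt_trans (kboth_r z r0) _; rewrite ltry.
    by move=> p _; rewrite gee0_abs// lee_fin; case/andP: (kboth01 r z p).
  have mF : measurable_fun setT F by case: sF.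
  have mw : measurable_fun setT (kboth r z).
    exact: (measurableT_comp (@measurable_kboth R n r) (pair1_measurable z)).
  have w0 p : 0 <= kboth r z p by case/andP: (kboth01 r z p).
  have Fw p : `|F p| * kboth r z p <= kboth r z p by rewrite ler_piMl.
  have h : \int[mu]_p (`|F p| * kboth r z p) <= rQ * 2 ^+ N.
    apply: (@le_trans _ _ (\int[mu]_p kboth r z p)).
      apply: le_Rintegral => //.
      apply: (le_integrable_EFin _ _ iw) => [|p].
        by apply: measurable_funM => //; exact: measurableT_comp.
      by rewrite normrM normr_id (ger0_norm (w0 p)).
    rewrite -lee_fin /Rintegral fineK; first exact: kboth_r.
    exact: integrable_fin_num iw.
  apply: (@le_trans _ _ (M * (rQ * 2 ^+ N))); first exact: ler_wpM2l.
  rewrite mulrCA ler_pM2l// -exprMn.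
  (* With y = M 2^N, the inequality y <= y^2 + 1 lets the L2 constant serve here as well. *)
  have := sqr_ge0 (M * 2 ^+ N - 1); have : 0 <= M * 2 ^+ N by rewrite mulr_ge0// (le_trans ler01).
  by nra.
Qed.

End Averages.

(** * The kinetic averages form an approximate identity *)

Section ApproximateIdentity.
Variables (R : realType) (n : nat).
Local Notation N := (2 * n).+1.
Local Notation T := (N.-tuple R).
Local Notation mu := (leb R N).
Local Notation sqnorm := (sqnorm mu).
Local Notation L2 := (square_integrable mu).
Implicit Types (r : R) (z p : T) (F : T -> R).

Definition box (a b : 'I_N -> R) : set T := [set p | forall j, a j < tnth p j < b j].

Definition cube (L : R) : set T := box (fun=> - L) (fun=> L).

Definition orthants : set (set T) :=
  [set A | exists a : 'I_N -> R, A = [set p | forall j, a j < tnth p j]].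

Lemma measurable_coord_itv (i : interval R) (j : 'I_N) :
  measurable [set p : T | tnth p j \in i].
Proof.
rewrite -[X in measurable X]setTI.
exact: (@measurable_tnth _ R N j measurableT [set` i]).
Qed.

Lemma measurable_box a b : measurable (box a b).
Proof.
rewrite (_ : box a b = \bigcap_(j in [set: 'I_N]) [set p : T | tnth p j \in `]a j, b j[]).
  by apply: fin_bigcap_measurable => // j _; exact: measurable_coord_itv.
apply/seteqP; split => [p h j _ /=|p h j]; first by rewrite in_itv /=.
by have := h j I; rewrite /= in_itv.
Qed.

Definition origin : T := [tuple 0 | j < N].

Lemma vel_origin j : vel origin j = 0.
Proof. by rewrite /vel; case: ifP => // _; rewrite tnth_mktuple. Qed.

Lemma kcoord_origin r p j : kcoord r origin p j = tnth p j / r ^+ hdeg j.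
Proof. by rewrite /kcoord vel_origin mulr0 subr0 tnth_mktuple subr0. Qed.

Lemma hdeg_gt0 (j : 'I_N) : (0 < hdeg j)%N.
Proof. by rewrite /hdeg; case: ifP => // _; case: ifP. Qed.

Lemma cube_kball L p : 1 <= L -> cube L p -> kball L origin p = 1.
Proof.
move=> L1 cp; have L0 : 0 < L by exact: lt_le_trans ltr01 L1.
rewrite kballE (_ : [forall _, _] = true)//; apply/forallP => j.
have /andP[h1 h2] := cp j; rewrite kcoord_origin.
have Ld : L <= L ^+ hdeg j by rewrite -[leLHS]expr1 ler_weXn2l// hdeg_gt0.
have Ld0 : 0 < L ^+ hdeg j by rewrite exprn_gt0.
by rewrite ler_pdivlMr// ler_pdivrMr//; apply/andP; split; lra.
Qed.

(** For L >= 1 the cube lies in the kinetic ball of radius L about the origin, whose volume is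
    known. *)
Lemma cube_finite L : 1 <= L -> (mu (cube L) < +oo)%E.
Proof.
move=> L1; have L0 : 0 < L by exact: lt_le_trans ltr01 L1.
have mc := measurable_box (fun=> - L) (fun=> L).
rewrite -[cube L]setIT -integral_indic//.
apply: (@le_lt_trans _ _ (kvol n L)%:E); last exact: ltry.
rewrite -(integral_kball origin L0); apply: ge0_le_integral => //.
- by apply/measurable_EFinP; exact: measurable_indic.
- apply/measurable_EFinP.
  exact: (measurableT_comp (@measurable_kball R n L) (pair1_measurable origin)).
- move=> p _; rewrite lee_fin indicE; case: (boolP (p \in cube L)) => [|_].
    by rewrite inE => /(cube_kball L1) ->.
  exact: kball_ge0.
Qed.

Lemma has_mass_point (c : R) : has_mass 0 (\1_[set c] : R -> R).
Proof.
move=> l a l0.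
have E x : (\1_[set c] ((x - a) / l) : R) = \1_(`[a + l * c, a + l * c]) x.
  rewrite !indicE; congr (nat_of_bool _)%:R; rewrite set_itv1.
  apply/idP/idP; rewrite !inE /= => h.
    by rewrite -h mulrC divfK ?gt_eqF//; lra.
  by rewrite h addrAC subrr add0r mulrC mulKf ?gt_eqF.
split.
  by under eq_fun do rewrite E; exact: integrable_indic_itv.
rewrite /Rintegral; under eq_integral do rewrite E.
by rewrite integral_indic//= setIT lebesgue_measure_itv /= lte_fin ltxx mulr0.
Qed.

(** The hyperplane is a countable union of slabs, whose indicators are product kernels with a
    one-point factor at [j] and hence have mass zero. *)
Lemma ae_coord_neq (j : 'I_N) (c : R) : {ae mu, forall p, tnth p j != c}.
Proof.
(* The kernel at scale m + 1 sees coordinates divided by (m + 1) to the power [hdeg], so the point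
   is rescaled accordingly. *)
pose g (m : nat) (k : 'I_N) : R -> R :=
  if k == j then \1_[set c / m.+1%:R ^+ hdeg j] else @unit_ball R.
have mg m k : measurable_fun setT (g m k).
  by rewrite /g; case: ifP => _; exact: measurable_indic.
have g0 m k x : 0 <= g m k x by rewrite /g; case: ifP => _; rewrite /unit_ball indicE.
have k0 m p : 0 <= kprod (g m) m.+1%:R origin p by apply: prodr_ge0 => k _.
have mk m := measurable_kprod2 m.+1%:R origin (mg m).
have ae0 m : {ae mu, forall p, kprod (g m) m.+1%:R origin p = 0}.
  have I0 : (\int[mu]_p `|(kprod (g m) m.+1%:R origin p)%:E| = 0)%E.
    under eq_integral do rewrite abse_EFin ger0_norm//.
    have mE : measurable_fun setT (fun p => (kprod (g m) m.+1%:R origin p)%:E).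
      exact/measurable_EFinP.
    rewrite -(leb_ge0 mE) => [|p]; last by rewrite lee_fin.
    rewrite (@itint_kprod _ _ _ _ (g m) (fun k => if k == j then 0 else 2)) ?ltr0n//.
      by rewrite (bigD1 j)//= eqxx mul0r mulr0.
    move=> k; rewrite /g; case: ifP => _; first exact: has_mass_point.
    exact: has_mass_unit_ball.
  have /ae_eq_integral_abs : measurable_fun setT (EFin \o kprod (g m) m.+1%:R origin).
    exact/measurable_EFinP.
  move=> /(_ mu measurableT)[+ _] => /(_ I0); apply: filterS => p /(_ I) /= [].
  by [].
have := ae_foralln ae0; apply: filterS => p hp; apply/eqP => pc.
have [m hm] : exists m : nat, forall k, `|tnth p k| <= m.+1%:R.
  exists (Num.truncn (\sum_k `|tnth p k|)) => k; apply: ltW.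
  apply: le_lt_trans (truncnS_gt _).
  by rewrite (bigD1 k)//= lerDl; apply: sumr_ge0.
have := hp m; apply/eqP; rewrite /kprod /prodf.
apply/prodf_neq0 => k _; rewrite kcoord_origin /g; case: (eqVneq k j) => [->|_].
  by rewrite pc indicE mem_set// oner_neq0.
have m1 : 1 <= m.+1%:R :> R by rewrite ler1n.
have Ld : m.+1%:R <= m.+1%:R ^+ hdeg k :> R by rewrite -[leLHS]expr1 ler_weXn2l// hdeg_gt0.
have Ld0 : 0 < m.+1%:R ^+ hdeg k :> R by rewrite exprn_gt0.
rewrite unit_ballE (_ : (_ <= _ <= _)%R = true) ?oner_neq0//.
have := hm k; rewrite ler_norml => /andP[h1 h2].
by rewrite ler_pdivlMr// ler_pdivrMr//; apply/andP; split; lra.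
Qed.

Lemma finite_lower_bound (I : finType) (d : I -> R) : (forall i, 0 < d i) ->
  exists2 e, 0 < e & forall i, e <= d i.
Proof.
move=> d0; have S0 : 0 <= \sum_i (d i)^-1.
  by apply: sumr_ge0 => i _; rewrite invr_ge0 ltW.
(* The added 1 keeps the witness positive when the index type is empty. *)
exists (1 + \sum_i (d i)^-1)^-1; first by rewrite invr_gt0 ltr_pwDl.
move=> i; rewrite -[leRHS]invrK lef_pV2 ?posrE ?invr_gt0 ?ltr_pwDl//.
rewrite (bigD1 i)//= addrCA lerDl addr_ge0//.
by apply: sumr_ge0 => k _; rewrite invr_ge0 ltW.
Qed.

Lemma near_halving (r0 e : R) : 0 < e -> \forall m \near \oo, r0 / 2 ^+ m < e.
Proof.
move=> e0; near=> m.
have h : r0 / e < m%:R by near: m; exact: nbhs_infty_gtr.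
rewrite ltr_pdivrMr ?exprn_gt0// mulrC -ltr_pdivrMr//.
apply: lt_le_trans h _; rewrite -natrX ler_nat ltnW// ltn_expl//.
Unshelve. all: by end_near. Qed.

(* Away from the faces of the box its indicator is locally constant, and the
   kernel based at z is supported in a small neighbourhood of z. *)
Lemma avg_box_near (r0 : R) a b z : 0 < r0 ->
  (forall j, tnth z j != a j /\ tnth z j != b j) ->
  \forall m \near \oo, avg (r0 / 2 ^+ m) (\1_(box a b)) z = \1_(box a b) z.
Proof.
move=> r00 zab.
have [e e0 he] : exists2 e, 0 < e & forall j,
    e <= Num.min `|tnth z j - a j| `|tnth z j - b j|.
  apply: finite_lower_bound => j; have [h1 h2] := zab j.
  by rewrite lt_min !normr_gt0 !subr_eq0 h1.
pose V := \sum_j `|vel z j|.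
have V0 : 0 <= V by exact: sumr_ge0.
have V1 : 0 < V + 1 by rewrite ltr_wpDl.
near=> m.
have rp : 0 < r0 / 2 ^+ m by rewrite divr_gt0// exprn_gt0.
have r1 : r0 / 2 ^+ m <= 1 by apply: ltW; near: m; exact: near_halving.
(* For r <= 1 every coordinate moves by at most r^2 V + r <= r (V + 1) on the support. *)
have re : r0 / 2 ^+ m < e / (V + 1) by near: m; apply: near_halving; rewrite divr_gt0.
move: rp r1 re; set r := r0 / 2 ^+ m => rp r1 re.
have rj (j : 'I_N) : r ^+ hdeg j <= r.
  by rewrite -[leRHS]expr1 ler_wiXn2l// ?(ltW rp)// hdeg_gt0.
have r2 : r ^+ 2 <= r by rewrite -[leRHS]expr1 ler_wiXn2l// (ltW rp).
apply: avg_cst => // p kp; have sb k : supp01 (@bumps R n k) by exact: supp01_bump.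
have near_p j : `|tnth p j - tnth z j| < e.
  apply: le_lt_trans (kprod_dist j rp sb kp) _.
  move: re; rewrite ltr_pdivlMr// => re; apply: le_lt_trans re.
  have vV : `|vel z j| <= V by rewrite /V (bigD1 j)//= lerDl sumr_ge0.
  rewrite mulrDr mulr1; apply: lerD => //.
  by apply: ler_pM => //; rewrite ?sqr_ge0.
rewrite !indicE; congr (nat_of_bool _)%:R.
(* A point closer to s than c is lies on the same side of c as s. *)
have side (s t c : R) : `|t - s| < `|s - c| -> (c < t) = (c < s).
  by have [sc|sc|->] := ltgtP s c;
    rewrite ?subrr ?normr0 ?normr_lt0// ltr_norml => /andP[h1 h2];
    [rewrite ltr0_norm in h1 h2 | rewrite gtr0_norm in h1 h2]; rewrite ?subr_lt0 ?subr_gt0//;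
    apply/idP/idP; lra.
have side2 (s t c : R) : `|t - s| < `|s - c| -> (t < c) = (s < c).
  by have [sc|sc|->] := ltgtP s c;
    rewrite ?subrr ?normr0 ?normr_lt0// ltr_norml => /andP[h1 h2];
    [rewrite ltr0_norm in h1 h2 | rewrite gtr0_norm in h1 h2]; rewrite ?subr_lt0 ?subr_gt0//;
    apply/idP/idP; lra.
have E j : (a j < tnth p j < b j) = (a j < tnth z j < b j).
  have := he j; rewrite le_min => /andP[ha hb].
  rewrite (side (tnth z j) (tnth p j) (a j)); last exact: lt_le_trans (near_p j) ha.
  rewrite (side2 (tnth z j) (tnth p j) (b j))//; exact: lt_le_trans (near_p j) hb.
by apply/idP/idP; rewrite !inE => h j; [rewrite -E|rewrite E]; exact: h.
Unshelve. all: by end_near. Qed.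

(** The shear involves the velocity of z, while p is the point known to be bounded. Velocities are
    not sheared, so that of z is bounded before the positions. *)
Lemma kprod_far g r z p L B : 0 < r -> r <= B -> 1 <= B -> (forall k : 'I_N, supp01 (g k)) ->
  cube L p -> kprod g r z p != 0 ->
  cube (L + B ^+ 3 + B ^+ 3 * (L + B ^+ 3)) z.
Proof.
move=> r0 rB B1 gs cp kp j.
have B0 : 0 <= B by exact: le_trans ler01 B1.
have L0 : 0 < L by have /andP[] := cp ord0; lra.
have rd k : (k <= 3)%N -> r ^+ k <= B ^+ 3.
  move=> k3; apply: (@le_trans _ _ (B ^+ k)); first by rewrite lerXn2r// nnegrE// ltW.
  exact: ler_weXn2l.
have hd k : (@hdeg n k <= 3)%N by rewrite /hdeg; case: ifP => // _; case: ifP.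
have B3 : 0 <= B ^+ 3 by exact: exprn_ge0.
have dist k : `|tnth z k| < L + (r ^+ 2 * `|vel z k| + B ^+ 3).
  have /andP[c1 c2] := cp k; have pL : `|tnth p k| < L by rewrite ltr_norml c1.
  have := kprod_dist k r0 gs kp; have := rd _ (hd k).
  have := ler_distD (tnth p k) (tnth z k) 0; rewrite !subr0 distrC; lra.
have velb k : `|vel z k| <= L + B ^+ 3.
  elim/coord_ind: k => [|i|i]; rewrite ?vel_t ?vel_v ?normr0 ?addr_ge0// ?(ltW L0)//.
  rewrite vel_x; have := dist (vidx i); rewrite vel_v normr0 mulr0 add0r; exact: ltW.
rewrite -ltr_norml; apply: lt_le_trans (dist j) _.
have : r ^+ 2 * `|vel z j| <= B ^+ 3 * (L + B ^+ 3).
  by apply: ler_pM => //; [exact: sqr_ge0|exact: rd].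
lra.
Qed.

(** Dominated convergence: the averages are eventually exact off the faces, a null set, and bounded
    by C + 1 on a fixed larger cube outside which they vanish. *)
Lemma approximated_box (r0 : R) a b L : 0 < r0 -> 1 <= L -> box a b `<=` cube L ->
  approximated mu (fun m => avg (r0 / 2 ^+ m)) (\1_(box a b)).
Proof.
move=> r00 L1 abL; have [C C0 hC] := avg_bound R n.
have rm m : 0 < r0 / 2 ^+ m by rewrite divr_gt0// exprn_gt0.
pose B := r0 + 1.
have B1 : 1 <= B by rewrite lerDr ltW.
have rB m : r0 / 2 ^+ m <= B.
  apply: (@le_trans _ _ r0); last by rewrite lerDl.
  by rewrite ler_pdivrMr ?exprn_gt0// ler_peMr ?(ltW r00)// exprn_ege1// ler1n.
set L' := L + B ^+ 3 + B ^+ 3 * (L + B ^+ 3).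
have B3 : 0 <= B ^+ 3 by apply: exprn_ge0; exact: le_trans ler01 B1.
have L0 : 0 <= L by exact: le_trans ler01 L1.
have LL' : L <= L' by rewrite /L' -addrA lerDl addr_ge0// mulr_ge0// addr_ge0.
have L1' : 1 <= L' by exact: le_trans L1 LL'.
have mb := measurable_box a b; have mc := measurable_box (fun=> - L') (fun=> L').
have cube_mono : cube L `<=` cube L'.
  by move=> p h j; have /andP[? ?] := h j; apply/andP; split; lra.
have sb : L2 (\1_(box a b)).
  apply: L2_indic => //; apply: le_lt_trans (cube_finite L1).
  by apply: le_measure => //; rewrite inE//; exact: measurable_box.
have sc : L2 (fun x => (C + 1) * \1_(cube L') x + 0).
  apply: L2_lin; last exact: L2_0.
  by apply: L2_indic => //; exact: cube_finite.
have ind1 (x : T) : `|\1_(box a b) x : R| <= 1.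
  by rewrite indicE; case: (_ \in _); rewrite ?normr1 ?normr0.
have gs k : supp01 (@bumps R n k) by exact: supp01_bump.
apply: (@L2_dominated_cvg _ _ _ mu (fun m => avg (r0 / 2 ^+ m) (\1_(box a b))) _ _ sc).
- by move=> m; case: (hC _ (rm m)) => h _ _ _ _; exact: h.
- exact: measurable_indic.
- move=> m x; rewrite addr0 indicE; case: (boolP (x \in cube L')) => [_|xL].
    by rewrite mulr1; case: (hC _ (rm m)) => _ _ _ _; apply.
  rewrite mulr0 (@avg_cst R n _ _ 0) ?normr0// => p kp.
  rewrite indicE memNset// => /abL pL; move: xL; rewrite notin_setE; apply.
  exact: kprod_far (rm m) (rB m) B1 gs pL kp.
- move=> x; rewrite addr0 !indicE; case: (boolP (x \in box a b)) => [|_]; last first.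
    by rewrite normr0 mulr_ge0// addr_ge0.
  by rewrite inE => /abL/cube_mono/mem_set ->; rewrite normr1 mulr1 lerDr.
(* The countable intersection is indexed by natural numbers, so the coordinates are enumerated
   through [inord]. *)
have ha := ae_foralln (fun k : nat => ae_coord_neq (inord k) (a (inord k))).
have hb := ae_foralln (fun k : nat => ae_coord_neq (inord k) (b (inord k))).
apply: filterS2 ha hb => x xa xb.
apply: cvg_near_cst; apply: avg_box_near => // j.
by have := xa j; have := xb j; rewrite inord_val.
Qed.

HB.instance Definition _ := isPointed.Build T origin.

Lemma orthants_generate : @measurable _ T = <<s orthants >>.
Proof.
apply/seteqP; split.
  have mid : measurable_fun setT (fun p : g_sigma_algebraType orthants => p : T).
    apply/measurable_fun_tnthP => j.
    apply: (measurability _ (RGenOInfty.measurableE R)) => _ [_ [x ->] <-].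
    (* A half-space in coordinate j is the increasing union of the orthants whose other corners are
       at -k. *)
    rewrite setTI (_ : _ @^-1` _ = \bigcup_k
      [set p : T | forall i, (if i == j then x else - k%:R) < tnth p i]).
      apply: bigcupT_measurable => k; apply: sub_sigma_algebra.
      by exists (fun i => if i == j then x else - k%:R).
    apply/seteqP; split => p /=; last first.
      by move=> [k _ /(_ j)]; rewrite eqxx in_itv /= andbT.
    rewrite in_itv /= andbT => xp.
    exists (Num.truncn (\sum_i `|tnth p i|)).+1 => // i; case: eqP => [->//|_].
    rewrite ltrNl; apply: le_lt_trans (truncnS_gt _).
    apply: le_trans (ler_norm _) _; rewrite normrN.
    by rewrite (bigD1 i)//= lerDl; apply: sumr_ge0.
  by move=> A mA; have := mid measurableT A mA; rewrite setTI.
apply: smallest_sub; first exact: sigma_algebra_measurable.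
move=> _ [a ->].
rewrite (_ : [set p | _] = \bigcap_(j in [set: 'I_N]) [set p : T | tnth p j \in `]a j, +oo[]).
  by apply: fin_bigcap_measurable => // j _; exact: measurable_coord_itv.
apply/seteqP; split => [p h j _ /=|p h j]; first by rewrite in_itv /= andbT.
by have := h j I; rewrite /= in_itv /= andbT.
Qed.

Lemma orthants_setI : setI_closed orthants.
Proof.
move=> _ _ [a ->] [b ->]; exists (fun j => Num.max (a j) (b j)).
apply/seteqP; split => p /= => [[ha hb] j|h].
  by rewrite gt_max ha hb.
by split=> j; have := h j; rewrite gt_max => /andP[].
Qed.

(** Orthants form a generating system stable under intersection, and an orthant cut by a cube is
    again a box, so the box case feeds the Dynkin argument. *)
Lemma avg_approximates (r0 : R) F : 0 < r0 -> L2 F ->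
  approximated mu (fun m => avg (r0 / 2 ^+ m)) F.
Proof.
move=> r00 sF; have [C C0 hC] := avg_bound R n.
have rm m : 0 < r0 / 2 ^+ m by rewrite divr_gt0// exprn_gt0.
have L1 m : 1 <= m.+1%:R :> R by rewrite ler1n.
apply: (@approximated_L2 _ _ _ mu (fun m => avg (r0 / 2 ^+ m)) C C0 _ _ _
  (fun m => cube m.+1%:R) orthants _ _ _ orthants_generate orthants_setI) => //.
- by move=> m G sG; case: (hC _ (rm m)) => h _ _ _ _; exact: h.
- by move=> m c G H sG sH; case: (hC _ (rm m)) => _ h _ _ _; exact: h.
- by move=> m G sG; case: (hC _ (rm m)) => _ _ h _ _; exact: h.
- by move=> m; exact: measurable_box.
- by move=> m; exact: cube_finite.
- move=> x; near=> m => j; rewrite -ltr_norml.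
  have h : \sum_k `|tnth x k| < m%:R by near: m; exact: nbhs_infty_gtr.
  apply: (@le_lt_trans _ _ (\sum_k `|tnth x k|)).
    by rewrite (bigD1 j)//= lerDl; apply: sumr_ge0.
  by apply: lt_le_trans h _; rewrite ler_nat.
- move=> m _ [a ->].
  rewrite (_ : _ `&` _ = box (fun j => Num.max (a j) (- m.+1%:R)) (fun=> m.+1%:R)).
    apply: (approximated_box r00 (L1 m)) => p h j.
    by have := h j; rewrite gt_max => /andP[/andP[_ ->] ->].
  apply/seteqP; split => p /= => [[ha hc] j|h].
    by rewrite gt_max ha /=; exact: hc.
  by split=> j; have := h j; rewrite gt_max => /andP[/andP[h1 h2] h3] //; rewrite h2 h3.
- by move=> m; exact: (approximated_box r00 (L1 m)).
Unshelve. all: by end_near. Qed.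

End ApproximateIdentity.

(** * Weak solutions tested against kernels *)

Section Identities.
Variables (R : realType) (n : nat).
Local Notation N := (2 * n).+1.
Local Notation Q := (2 + 4 * n)%N.
Local Notation T := (N.-tuple R).
Local Notation mu := (leb R N).
Local Notation sqnorm := (sqnorm mu).
Local Notation L2 := (square_integrable mu).
Implicit Types (r : R) (z p : T) (g h : 'I_N -> R -> R) (F : T -> R).

Lemma L2sqE F : measurable_fun setT F -> L2sq F = sqnorm F.
Proof.
move=> mF; rewrite /L2sq leb_ge0//; first exact: measurable_sq.
by move=> p; rewrite lee_fin sqr_ge0.
Qed.

Lemma L1normE F : measurable_fun setT F -> L1norm F = (\int[mu]_p `|F p|%:E)%E.
Proof.
move=> mF; rewrite /L1norm leb_ge0//.
by apply/measurable_EFinP; exact: measurableT_comp.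
Qed.

Lemma Rintegral_sum (I : Type) (s : seq I) (F : I -> T -> R) :
  (forall i, mu.-integrable setT (EFin \o F i)) ->
  mu.-integrable setT (EFin \o (fun p => \sum_(i <- s) F i p)) /\
  \int[mu]_p (\sum_(i <- s) F i p) = \sum_(i <- s) \int[mu]_p F i p.
Proof.
move=> iF; elim: s => [|i s [IHi IHe]].
  split.
    by under eq_fun do rewrite big_nil; exact: integrable0.
  rewrite big_nil /Rintegral; under eq_integral do rewrite big_nil.
  by rewrite integral0.
under eq_fun do rewrite big_cons.
split; first exact: (integrableD measurableT (iF i) IHi).
by rewrite big_cons -IHe (RintegralD measurableT (iF i) IHi).
Qed.

Lemma integrable_kprod r g z F : 0 < r -> good_factors g -> L2 F ->
  mu.-integrable setT (EFin \o (fun p => F p * kprod g r z p)).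
Proof.
move=> r0 gg sF; have [M M0 hM] := kernel_bound gg.
exact: integrable_kop gg r0 (hM r r0) z F sF.
Qed.

Lemma integral_R_EFin F : mu.-integrable setT (EFin \o F) ->
  integral_R F = (\int[mu]_p F p)%:E.
Proof.
move=> iF; rewrite /integral_R leb_integrable// /Rintegral fineK//.
exact: integrable_fin_num iF.
Qed.

Lemma integral_R_kop (I : Type) (s : seq I) r (c : R) (F : I -> T -> R) (g : I -> 'I_N -> R -> R) z :
  0 < r -> (forall i, good_factors (g i)) -> (forall i, L2 (F i)) ->
  integral_R (fun p => c * \sum_(i <- s) F i p * kprod (g i) r z p) =
  (c * \sum_(i <- s) kop (g i) r (F i) z)%:E.
Proof.
move=> r0 gg sF.
have [iS IS] := @Rintegral_sum _ s (fun i p => F i p * kprod (g i) r z p)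
  (fun i => integrable_kprod z r0 (gg i) (sF i)).
rewrite integral_R_EFin; last exact: (integrableZl measurableT c iS).
by rewrite RintegralZl// IS.
Qed.

Definition weak_solution (f : T -> R) (S G : 'I_n -> T -> R) : Prop :=
  [/\ L2 f, (forall i, L2 (S i)), (forall i, L2 (G i)),
    (forall (i : 'I_n) (phi : T -> R), test_fun phi ->
       integral_R (fun p => f p * pderiv (vidx i) phi p)
       = oppe (integral_R (fun p => G i p * phi p))) &
    (forall phi : T -> R, test_fun phi ->
       integral_R (fun p => f p * (pderiv (tidx n) phi p
                    + \sum_(i < n) vcoord p i * pderiv (xidx i) phi p))
       = integral_R (fun p => \sum_(i < n) S i p * pderiv (vidx i) phi p))].

Lemma good_smooth1 g : good_factors g -> forall k, smooth1 (g k).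
Proof. by move=> gg k; case: (gg k). Qed.

Section Solution.
Variables (f : T -> R) (S G : 'I_n -> T -> R) (r : R).
Hypothesis sol : weak_solution f S G.
Hypothesis r0 : 0 < r.

Let sf : L2 f. Proof. by case: sol. Qed.
Let sS i : L2 (S i). Proof. by case: sol. Qed.
Let sG i : L2 (G i). Proof. by case: sol. Qed.
Let rn0 : r != 0. Proof. by rewrite gt_eqF. Qed.

(** The kernel is the test function for G = grad_v f; its v derivative carries 1 / r, which becomes
    the gained factor r. *)
Lemma kop_dv g i z : good_factors g ->
  kop (dfactor g (vidx i)) r f z = - (r * kop g r (G i) z).
Proof.
move=> gg; have gs := good_smooth1 gg.
have [_ _ _ /(_ i _ (test_fun_kprod z r0 gg)) h _] := sol.
have := h.
(* A one-term sum, to match the shape of [integral_R_kop]. *)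
have -> : (fun p => f p * pderiv (vidx i) (kprod g r z) p) =
   (fun p => r^-1 * \sum_(k <- [:: tt]) f p * kprod (dfactor g (vidx i)) r z p).
  by apply/funext => p; rewrite vderiv_kprod// big_seq1; ring.
have -> : (fun p => G i p * kprod g r z p) =
   (fun p => 1 * \sum_(k <- [:: tt]) G i p * kprod g r z p).
  by apply/funext => p; rewrite big_seq1 mul1r.
rewrite (@integral_R_kop _ _ _ _ (fun=> f) (fun=> dfactor g (vidx i)))//; last first.
  by move=> _; exact: good_dfactor.
rewrite (@integral_R_kop _ _ _ _ (fun=> G i) (fun=> g))// !big_seq1 mul1r -EFinN => -[] e.
by rewrite -mulrN -e mulVKf.
Qed.

(** Tested on the kernel, the equation has r^-2 on the transport side and r^-1 on the side of S; the
    quotient is the gained factor r. *)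
Lemma kop_transport g z : good_factors g ->
  kop (dfactor g (tidx n)) r f z +
  \sum_(i < n) kop (mulw i (dfactor g (xidx i))) r f z =
  r * \sum_(k < n) kop (dfactor g (vidx k)) r (S k) z.
Proof.
move=> gg; have gs := good_smooth1 gg.
have [_ _ _ _ /(_ _ (test_fun_kprod z r0 gg)) h] := sol.
have := h.
(* [None] stands for t and [Some i] for x_i, so the transport term becomes a single sum. *)
pose gi (o : option 'I_n) := if o is Some i then mulw i (dfactor g (xidx i)) else dfactor g (tidx n).
pose s := None :: [seq Some i | i <- index_enum 'I_n].
have -> : (fun p => f p * (pderiv (tidx n) (kprod g r z) p
    + \sum_(i < n) vcoord p i * pderiv (xidx i) (kprod g r z) p)) =
   (fun p => (r ^+ 2)^-1 * \sum_(o <- s) f p * kprod (gi o) r z p).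
  apply/funext => p; rewrite transport_kprod// big_cons big_map /= -mulr_sumr; ring.
have -> : (fun p => \sum_(i < n) S i p * pderiv (vidx i) (kprod g r z) p) =
   (fun p => r^-1 * \sum_(i <- index_enum 'I_n) S i p * kprod (dfactor g (vidx i)) r z p).
  apply/funext => p; rewrite mulr_sumr; apply: eq_bigr => i _.
  by rewrite vderiv_kprod//; ring.
rewrite (@integral_R_kop _ _ _ _ (fun=> f) gi)//; last first.
  by case=> [i|]; [apply: good_mulw|]; exact: good_dfactor.
rewrite (@integral_R_kop _ _ _ _ S (fun i => dfactor g (vidx i)))//; last first.
  by move=> i; exact: good_dfactor.
rewrite big_cons big_map /= => -[] e.
have -> : \sum_(k < n) kop (dfactor g (vidx k)) r (S k) z =
  r * (r^-1 * \sum_(k < n) kop (dfactor g (vidx k)) r (S k) z) by rewrite mulVKf.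
rewrite -e; field.
exact: rn0.
Qed.

Lemma dfactorC g a b : dfactor (dfactor g a) b = dfactor (dfactor g b) a.
Proof.
by apply/funext => k; rewrite /dfactor; case: ifP => // _; case: ifP.
Qed.

Lemma dfactor_mulw g i a : a != vidx i -> dfactor (mulw i g) a = mulw i (dfactor g a).
Proof.
move=> ai; apply/funext => k; rewrite /dfactor /mulw.
by case: (eqVneq k a) => // ->; rewrite (negbTE ai).
Qed.

Lemma vidx_inj : injective (@vidx n).
Proof.
by move=> i j /(congr1 val) /=; rewrite !val_vidx => h; apply/val_inj => /=; lia.
Qed.

Lemma xidx_neq_vidx (i j : 'I_n) : xidx i != vidx j.
Proof. by rewrite -val_eqE /= val_xidx val_vidx; have := ltn_ord i; lia. Qed.

(** The Leibniz rule for the product of the v_i coordinate with the kernel; the extra term is the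
    commutator. *)
Lemma kop_dv_mulw g i F z : good_factors g -> L2 F ->
  kop (dfactor (mulw i g) (vidx i)) r F z =
  kop g r F z + kop (mulw i (dfactor g (vidx i))) r F z.
Proof.
move=> gg sF; rewrite /kop /kernel_op -RintegralD//.
- congr Rintegral; apply/funext => p /=; rewrite -mulrDr; congr (_ * _).
  rewrite /kprod /prodf dfactorE.
  have -> : \prod_j mulw i (dfactor g (vidx i)) j (kcoord r z p j) =
    kcoord r z p (vidx i) * (derive1 (g (vidx i)) (kcoord r z p (vidx i)) *
      \prod_(k | k != vidx i) g k (kcoord r z p k)).
    by rewrite -[LHS]/(kprod (mulw i (dfactor g (vidx i))) r z p) kprod_mulw /kprod /prodf dfactorE.
  rewrite [in RHS](bigD1 (vidx i))//=.
  have -> : \prod_(k | k != vidx i) mulw i g k (kcoord r z p k) =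
     \prod_(k | k != vidx i) g k (kcoord r z p k).
    by apply: eq_bigr => k /negbTE ki; rewrite /mulw ki.
  have -> : derive1 (mulw i g (vidx i)) (kcoord r z p (vidx i)) =
    g (vidx i) (kcoord r z p (vidx i)) +
    kcoord r z p (vidx i) * derive1 (g (vidx i)) (kcoord r z p (vidx i)).
    set x := kcoord _ _ _ _; rewrite /mulw eqxx.
    have d := is_deriveM (is_derive_id x (1 : R)) (smooth1_is_derive x (good_smooth1 gg (vidx i))).
    rewrite derive1E (@derive_val _ _ _ _ _ _ _ d) /GRing.scale /= mulr1.
    by rewrite addrC.
  by ring.
- exact: (integrable_kprod z r0 gg sF).
- by apply: (integrable_kprod z r0 _ sF); apply/good_mulw/good_dfactor.
Qed.

(* The missing derivative in x is the commutator of the derivative in v with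
   the transport operator. *)
Lemma kop_dx g i z : good_factors g ->
  kop (dfactor g (xidx i)) r f z =
  - (r * (kop (dfactor g (tidx n)) r (G i) z +
     \sum_(k < n) kop (mulw k (dfactor g (xidx k))) r (G i) z +
     \sum_(k < n) kop (dfactor (dfactor g (vidx i)) (vidx k)) r (S k) z)).
Proof.
move=> gg; have := kop_transport z (good_dfactor (vidx i) gg).
rewrite dfactorC kop_dv; last exact: good_dfactor.
(* Only for k = i does the weight fail to commute with the v_i derivative, and the defect is exactly
   the x_i derivative sought. *)
have E (k : 'I_n) : kop (mulw k (dfactor (dfactor g (vidx i)) (xidx k))) r f z =
  - (r * kop (mulw k (dfactor g (xidx k))) r (G i) z) -
  (if k == i then kop (dfactor g (xidx i)) r f z else 0).
  rewrite -kop_dv; last by apply/good_mulw/good_dfactor.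
  have [->|ki] := eqVneq k i.
    rewrite kop_dv_mulw//; last exact: good_dfactor.
    by rewrite addrC addKr dfactorC.
  rewrite subr0 dfactor_mulw; last by apply: contraNneq ki => /vidx_inj ->.
  by rewrite dfactorC.
under eq_bigr do rewrite E.
rewrite big_split /= !sumrN -!mulr_sumr -big_mkcond /= big_pred1_eq.
lra.
Qed.

(** The weight in v_i commutes with the x_i derivative, so the weighted terms of the transport
    operator are x_i derivatives of the kernels [mulw i g], to which [kop_dx] applies. *)
Lemma kop_dt g z : good_factors g ->
  kop (dfactor g (tidx n)) r f z =
  r * \sum_(k < n) kop (dfactor g (vidx k)) r (S k) z -
  \sum_(i < n) kop (dfactor (mulw i g) (xidx i)) r f z.
Proof.
move=> gg; rewrite -kop_transport//.
under [X in _ = _ - X]eq_bigr do rewrite dfactor_mulw ?xidx_neq_vidx//.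
by rewrite addrK.
Qed.

End Solution.

Definition energy (S G : 'I_n -> T -> R) : R :=
  \sum_(i < n) fine (sqnorm (G i)) + \sum_(i < n) fine (sqnorm (S i)).

(* The factor [r ^+ (2 * Q)] is the squared volume of a ball of radius r. *)
Definition controlled (E : R -> (T -> R) -> ('I_n -> T -> R) -> ('I_n -> T -> R) -> T -> R) :=
  exists C : R, 0 <= C /\ forall r f S G, 0 < r -> weak_solution f S G ->
    measurable_fun setT (E r f S G) /\
    (sqnorm (E r f S G) <= (C * r ^+ (2 * Q) * energy S G)%:E)%E.

Lemma sqnorm_fin F : L2 F -> sqnorm F \is a fin_num.
Proof. by move=> [_ F2]; rewrite ge0_fin_numE// sqnorm_ge0. Qed.

Lemma fine_sqnorm_ge0 F : 0 <= fine (sqnorm F).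
Proof. by rewrite fine_ge0// sqnorm_ge0. Qed.

Lemma energy_ge0 S G : 0 <= energy S G.
Proof. by rewrite addr_ge0// sumr_ge0// => i _; exact: fine_sqnorm_ge0. Qed.

Lemma controlled_kop g (H : ('I_n -> T -> R) -> ('I_n -> T -> R) -> T -> R) :
  good_factors g ->
  (forall f S G, weak_solution f S G -> L2 (H S G) /\ (fine (sqnorm (H S G)) <= energy S G)) ->
  controlled (fun r f S G => kop g r (H S G)).
Proof.
move=> gg hH; have [M M0 hM] := kernel_bound gg.
exists ((M * 2 ^+ N) ^+ 2); split; first exact: sqr_ge0.
move=> r f S G r0 sol; have [sH eH] := hH f S G sol; split.
  by apply: measurable_kop => //; case: sH.
apply: (le_trans (sqnorm_kop gg r0 (hM r r0) sH)).
rewrite -(fineK (sqnorm_fin sH)) -EFinM lee_fin.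
have -> : (M * 2 ^+ N) ^+ 2 * r ^+ (2 * Q) = (M * kvol n r) ^+ 2.
  rewrite [(2 * Q)%N]mulnC exprM /kvol !exprMn; ring.
by apply: ler_wpM2l => //; exact: sqr_ge0.
Qed.

Lemma controlledG g i : good_factors g -> controlled (fun r f S G => kop g r (G i)).
Proof.
move=> gg; apply: (@controlled_kop g (fun S G => G i)) => // f S G [_ _ sG _ _].
split=> //; rewrite /energy (bigD1 i)//= -addrA lerDl addr_ge0// sumr_ge0// => k _;
  exact: fine_sqnorm_ge0.
Qed.

Lemma controlledS g i : good_factors g -> controlled (fun r f S G => kop g r (S i)).
Proof.
move=> gg; apply: (@controlled_kop g (fun S G => S i)) => // f S G [_ sS _ _ _].
split=> //; rewrite /energy [X in _ + X](bigD1 i)//= addrCA lerDl addr_ge0// sumr_ge0// => k _;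
  exact: fine_sqnorm_ge0.
Qed.

Lemma controlledD E1 E2 : controlled E1 -> controlled E2 ->
  controlled (fun r f S G z => E1 r f S G z + E2 r f S G z).
Proof.
move=> [C1 [C10 h1]] [C2 [C20 h2]]; exists (2 * (C1 + C2)); split.
  by rewrite mulr_ge0// addr_ge0.
move=> r f S G r0 sol; have [m1 e1] := h1 r f S G r0 sol; have [m2 e2] := h2 r f S G r0 sol.
split; first exact: measurable_funD.
have := @sqnormD _ _ _ mu _ _ m1 m2; move=> /le_trans; apply.
apply: (@le_trans _ _ (2%:E * ((C1 * r ^+ (2 * Q) * energy S G)%:E + (C2 * r ^+ (2 * Q) * energy S G)%:E))%E).
  by apply: lee_wpmul2l => //; exact: leeD.
by rewrite -EFinD -EFinM lee_fin -!mulrA -mulrDl mulrA.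
Qed.

Lemma controlledZ (c : R) E : controlled E ->
  controlled (fun r f S G z => c * E r f S G z).
Proof.
move=> [C [C0 h]]; exists (c ^+ 2 * C); split; first by rewrite mulr_ge0 ?sqr_ge0.
move=> r f S G r0 sol; have [m e] := h r f S G r0 sol; split; first exact: measurable_funM.
rewrite sqnormZ// (_ : c ^+ 2 * C * _ * _ = c ^+ 2 * (C * r ^+ (2 * Q) * energy S G)); last by rewrite !mulrA.
rewrite [X in (_ <= X)%E]EFinM; apply: lee_wpmul2l => //.
by rewrite lee_fin sqr_ge0.
Qed.

Lemma controlled0 : controlled (fun r f S G z => 0).
Proof.
exists 0; split=> // r f S G r0 sol; split; first exact: measurable_cst.
by rewrite !mul0r sqnorm0.
Qed.

Lemma controlled_sum (I : Type) (s : seq I) E : (forall i : I, controlled (E i)) ->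
  controlled (fun r f S G z => \sum_(i <- s) E i r f S G z).
Proof.
move=> hE; elim: s => [|i s IH].
  have [C [C0 h]] := controlled0; exists C; split=> // r f S G r0 sol.
  have -> : (fun z => \sum_(i <- [::]) E i r f S G z) = (fun=> 0).
    by apply/funext => z; rewrite big_nil.
  exact: h r f S G r0 sol.
have [C [C0 h]] := controlledD (hE i) IH; exists C; split=> // r f S G r0 sol.
have -> : (fun z => \sum_(k <- i :: s) E k r f S G z) =
    (fun z => E i r f S G z + \sum_(k <- s) E k r f S G z).
  by apply/funext => z; rewrite big_cons.
exact: h r f S G r0 sol.
Qed.

(** The quotient by r is a combination of averages of S and G, given by one formula for all r and
    all solutions, so its constant is uniform. The x derivatives come before the t derivative, which
    is reduced to them. *)
Lemma kop_derivative_controlled g j : good_factors g ->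
  exists2 E, controlled E & forall r f S G z, 0 < r -> weak_solution f S G ->
    kop (dfactor g j) r f z = r * E r f S G z.
Proof.
have HX g' i : good_factors g' -> exists2 E, controlled E &
    forall r f S G z, 0 < r -> weak_solution f S G ->
    kop (dfactor g' (xidx i)) r f z = r * E r f S G z.
  move=> gg; exists (fun r f S G z => (-1) * (kop (dfactor g' (tidx n)) r (G i) z +
     \sum_(k < n) kop (mulw k (dfactor g' (xidx k))) r (G i) z +
     \sum_(k < n) kop (dfactor (dfactor g' (vidx i)) (vidx k)) r (S k) z)).
    apply: controlledZ; apply: (@controlledD (fun r f S G z => kop (dfactor g' (tidx n)) r (G i) z +
     \sum_(k < n) kop (mulw k (dfactor g' (xidx k))) r (G i) z)).
      apply: (@controlledD (fun r f S G z => kop (dfactor g' (tidx n)) r (G i) z)).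
        by apply: (controlledG i); exact: good_dfactor.
      apply: (@controlled_sum _ _ (fun k r f S G z => kop (mulw k (dfactor g' (xidx k))) r (G i) z)) => k.
      by apply: (controlledG i); apply/good_mulw/good_dfactor.
    apply: (@controlled_sum _ _ (fun k r f S G z => kop (dfactor (dfactor g' (vidx i)) (vidx k)) r (S k) z)) => k.
    by apply: (controlledS k); do 2 apply: good_dfactor.
  by move=> r f S G z r0 sol; rewrite (kop_dx sol r0 i z gg) mulN1r mulrN.
move=> gg; elim/coord_ind: j => [|i|i]; last 2 first.
- exact: HX.
- exists (fun r f S G z => (-1) * kop g r (G i) z); first exact/controlledZ/controlledG.
  by move=> r f S G z r0 sol; rewrite (kop_dv sol r0 i z gg) mulN1r mulrN.
have /choice[E hE] i : exists E, controlled E /\ forall r f S G z, 0 < r -> weak_solution f S G ->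
    kop (dfactor (mulw i g) (xidx i)) r f z = r * E r f S G z.
  by have [E ? ?] := HX _ i (good_mulw i gg); exists E.
exists (fun r f S G z => \sum_(k < n) kop (dfactor g (vidx k)) r (S k) z +
   (-1) * \sum_(i < n) E i r f S G z).
  apply: (@controlledD (fun r f S G z => \sum_(k < n) kop (dfactor g (vidx k)) r (S k) z)).
    apply: (@controlled_sum _ _ (fun k r f S G z => kop (dfactor g (vidx k)) r (S k) z)) => k.
    by apply: (controlledS k); exact: good_dfactor.
  apply: controlledZ; apply: (@controlled_sum _ _ E) => i; by case: (hE i).
move=> r f S G z r0 sol; rewrite (kop_dt sol r0 z gg) mulN1r mulrBr mulr_sumr; congr (_ - _).
by rewrite mulr_sumr; apply: eq_bigr => i _; case: (hE i) => _; apply.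
Qed.

End Identities.

(** Induction on a_0 A - b_0 B = (a_0 - b_0) A + b_0 (A - B), where A and B are the products of the
    remaining factors. *)
Lemma prod_telescope (R : comNzRingType) k (a b : 'I_k -> R) :
  \prod_i a i - \prod_i b i =
  \sum_(j < k) \prod_(i < k) (if (i < j)%N then b i else if i == j then a i - b i else a i).
Proof.
elim: k a b => [|k IH] a b; first by rewrite !big_ord0 subrr.
rewrite [in RHS]big_ord_recl !big_ord_recl /=.
under [X in _ = _ + X]eq_bigr do rewrite big_ord_recl /=.
rewrite -mulr_sumr; have := IH (fun i => a (lift ord0 i)) (fun i => b (lift ord0 i)).
under [X in _ = X -> _]eq_bigr do under eq_bigr do rewrite -(inj_eq (@lift_inj _ ord0)).
move=> h; rewrite [X in _ = _ + _ * X](_ : _ =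
  \prod_(i < k) a (lift ord0 i) - \prod_(i < k) b (lift ord0 i)); last by rewrite h.
ring.
Qed.

(** * The Nash inequality *)

Section Telescoping.
Variables (R : realType) (n : nat).
Local Notation N := (2 * n).+1.
Local Notation Q := (2 + 4 * n)%N.
Local Notation T := (N.-tuple R).
Local Notation mu := (leb R N).
Local Notation sqnorm := (sqnorm mu).
Local Notation L2 := (square_integrable mu).
Implicit Types (r : R) (z p : T) (F : T -> R).

(* The bump has mass one, so its difference with its rescaling is the derivative
   of a compactly supported function; the factors are exchanged one at a time. *)
Definition halving (j : 'I_N) : 'I_N -> R -> R := fun k =>
  if (k < j)%N then fun s => 2 ^+ hdeg k * smooth_bump (2 ^+ hdeg k * s)
  else if k == j then step_diff (2 ^+ hdeg k) else @smooth_bump R.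

Lemma good_halving j : good_factors (halving j).
Proof.
have l1 (k : 'I_N) : 1 <= 2 ^+ hdeg k :> R by rewrite exprn_ege1// ler1n.
move=> k; rewrite /halving; case: ifP => _; last case: ifP => _; split.
- rewrite (_ : (fun s => _) = (cst (2 ^+ hdeg k) * (fun s => @smooth_bump R (2 ^+ hdeg k * s + 0)))).
    by apply: smooth1M; [exact: smooth1_cst|apply: smooth1_affine; exact: smooth1_bump].
  by apply/funext => s; rewrite -[X in smooth_bump X]addr0.
- move=> x; rewrite negb_and -!ltNge => /orP x01.
  rewrite supp01_bump ?mulr0// negb_and -!ltNge; apply/orP.
  have := l1 k; set l := 2 ^+ _ => hl.
  by case: x01 => h; [left; rewrite pmulr_rlt0//; lra|right; nra].
- exact: smooth1_step_diff.
- exact: supp01_step_diff.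
- exact: smooth1_bump.
- exact: supp01_bump.
Qed.

Lemma kcoord_half r z p j : kcoord (r / 2) z p j = 2 ^+ hdeg j * kcoord r z p j.
Proof. by rewrite /kcoord expr_div_n invfM invrK; ring. Qed.

Lemma kprod_halving r z p :
  kprod (@bumps R n) r z p - 2 ^+ Q * kprod (@bumps R n) (r / 2) z p =
  \sum_j kprod (dfactor (halving j) j) r z p.
Proof.
(* The factor 2^Q splits into 2^[hdeg k] over the coordinates, which gives each rescaled bump mass
   one again. *)
rewrite /kprod /prodf -(@sum_hdeg n) -prodrXr -big_split /=.
under [X in _ - X]eq_bigr do rewrite kcoord_half.
rewrite (prod_telescope (fun k => bumps k (kcoord r z p k))); apply: eq_bigr => j _.
apply: eq_bigr => k _; rewrite /dfactor /halving.
case: (eqVneq k j) => [->|kj]; first by rewrite ltnn derive_step_diff.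
by case: ifP.
Qed.

Lemma avg_halving r F z : 0 < r -> L2 F ->
  avg r F z - avg (r / 2) F z =
  (r ^+ Q)^-1 * \sum_j kop (dfactor (halving j) j) r F z.
Proof.
move=> r0 sF; have r20 : 0 < r / 2 by rewrite divr_gt0.
have gh j := good_dfactor j (good_halving j).
have [_ <-] := @Rintegral_sum R n _ (index_enum 'I_N)
   (fun j p => F p * kprod (dfactor (halving j) j) r z p)
   (fun j => integrable_kprod z r0 (gh j) sF).
rewrite (_ : (fun p => _) = (fun p => F p * kprod (@bumps R n) r z p -
    2 ^+ Q * (F p * kprod (@bumps R n) (r / 2) z p))); last first.
  by apply/funext => p; rewrite -mulr_sumr -kprod_halving mulrBr [in RHS]mulrCA.
have i1 := integrable_kprod z r0 (@good_bumps R n) sF.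
have i2 := integrable_kprod z r20 (@good_bumps R n) sF.
rewrite (RintegralB measurableT i1 (integrableZl measurableT _ i2)) RintegralZl//.
rewrite -[X in _ = _ * (X - _)]/(kop (@bumps R n) r F z).
rewrite -[X in _ = _ * (_ - _ * X)]/(kop (@bumps R n) (r / 2) F z).
rewrite /avg expr_div_n invf_div [RHS]mulrBr; congr (_ - _).
by rewrite [RHS]mulrA; congr (_ * _); rewrite mulrC.
Qed.

(** The normalization r^-Q, squared, cancels the r^(2Q) of [controlled]; the r^2 that remains is the
    square of the factor gained from each derivative. *)
Lemma avg_halving_bound : exists2 C : R, 0 <= C &
  forall r f S G, 0 < r -> weak_solution f S G ->
  (sqnorm (fun z => avg r f z - avg (r / 2) f z)%R <= (C * r ^+ 2 * energy S G)%:E)%E.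
Proof.
have /choice[E hE] j : exists E, @controlled R n E /\
    forall r f S G z, 0 < r -> weak_solution f S G ->
    kop (dfactor (halving j) j) r f z = r * E r f S G z.
  by have [E ? ?] := kop_derivative_controlled j (good_halving j); exists E.
have [C [C0 hC]] := @controlled_sum R n _ (index_enum 'I_N) E (fun j => proj1 (hE j)).
exists C => // r f S G r0 sol; have [mE bE] := hC r f S G r0 sol.
have sf : L2 f by case: sol.
rewrite (_ : (fun z => _) = (fun z => (r / r ^+ Q) * \sum_j E j r f S G z)%R); last first.
  apply/funext => z; rewrite avg_halving// [r / _]mulrC -mulrA; congr (_ * _).
  rewrite mulr_sumr; by apply: eq_bigr => j _; rewrite (proj2 (hE j) r f S G z r0 sol).
rewrite sqnormZ//.
rewrite (_ : C * r ^+ 2 * energy S G = (r / r ^+ Q) ^+ 2 * (C * r ^+ (2 * Q) * energy S G)).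
  by rewrite [X in (_ <= X)%E]EFinM; apply: lee_wpmul2l => //; rewrite lee_fin sqr_ge0.
rewrite [(2 * Q)%N]mulnC exprM; have : r ^+ Q != 0 by rewrite expf_neq0// gt_eqF.
by set a := r ^+ Q => a0; field.
Qed.

Lemma sqnorm_distC F G : sqnorm (fun z => F z - G z) = sqnorm (fun z => G z - F z).
Proof. by apply: eq_integral => z _; rewrite -sqrrN opprB. Qed.

(** The bound reproduces itself: if C is the one-step constant, then 2 (C r^2 + 4 C (r / 2)^2) = 4 C
    r^2, uniformly in m. *)
Lemma avg_dyadic_bound : exists2 C : R, 0 <= C &
  forall m r f S G, 0 < r -> weak_solution f S G ->
  (sqnorm (fun z => avg r f z - avg (r / 2 ^+ m) f z)%R <= (C * r ^+ 2 * energy S G)%:E)%E.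
Proof.
have [C C0 hC] := avg_halving_bound; exists (4 * C); first exact: mulr_ge0.
have [D D0 hD] := avg_bound R n.
move=> m r f S G r0 sol; have sf : L2 f by case: sol.
elim: m r r0 => [|m IH] r r0.
  have -> : (fun z => avg r f z - avg (r / 2 ^+ 0) f z) = (fun=> 0).
    by apply/funext => z; rewrite expr0 divr1 subrr.
  rewrite sqnorm0 lee_fin; apply: mulr_ge0; last exact: energy_ge0.
  by apply: mulr_ge0; [exact: mulr_ge0|exact: sqr_ge0].
have r20 : 0 < r / 2 by rewrite divr_gt0.
have mavg s : 0 < s -> measurable_fun setT (avg s f).
  by move=> s0; case: (hD s s0) => h _ _ _ _; exact: h.
have rm : 0 < r / 2 / 2 ^+ m by rewrite divr_gt0// exprn_gt0.
rewrite (_ : (fun z => _) = (fun z => (avg r f z - avg (r / 2) f z) +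
    (avg (r / 2) f z - avg (r / 2 / 2 ^+ m) f z))%R); last first.
  by apply/funext => z; rewrite addrA subrK exprS invfM mulrA.
have := @sqnormD _ _ _ mu _ _ (measurable_funB (mavg _ r0) (mavg _ r20))
  (measurable_funB (mavg _ r20) (mavg _ rm)).
move=> /le_trans; apply.
apply: (@le_trans _ _ (2%:E * ((C * r ^+ 2 * energy S G)%:E + (4 * C * (r / 2) ^+ 2 * energy S G)%:E))%E).
  by apply: lee_wpmul2l => //; apply: leeD; [exact: hC|exact: IH].
by rewrite -EFinD -EFinM lee_fin le_eqVlt; apply/orP; left; apply/eqP; field.
Qed.

(** Write f as (f - f_s) + (f_s - f_r) + f_r with s = r / 2^m. The first term is made small by
    taking m large, while the bounds on the other two do not depend on m. *)
Lemma sqnorm_interpolation : exists2 K : R, 0 <= K &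
  forall r f S G (A : R), 0 < r -> weak_solution f S G ->
  (\int[mu]_p `|f p|%:E = A%:E)%E ->
  fine (sqnorm f) <= K * (r ^+ 2 * energy S G + (r ^+ Q)^-1 * A ^+ 2).
Proof.
have [C C0 hC] := avg_dyadic_bound; have [D D0 hD] := avg_bound R n.
exists (4 * (C + D)); first by rewrite mulr_ge0// addr_ge0.
move=> r f S G A r0 sol fA; have sf : L2 f by case: sol.
have e0 := energy_ge0 S G.
apply/ler_addgt0Pr => e egt0.
have e2 : 0 < e / 2 by rewrite divr_gt0.
have [m _ /(_ m (leqnn m)) am] := avg_approximates r0 sf e2.
have rm : 0 < r / 2 ^+ m by rewrite divr_gt0// exprn_gt0.
have mavg s : 0 < s -> measurable_fun setT (avg s f).
  by move=> s0; case: (hD s s0) => h _ _ _ _; exact: h.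
have mf : measurable_fun setT f by case: sf.
rewrite sqnorm_distC in am.
have bD : (sqnorm (avg r f) <= (D / r ^+ Q * A ^+ 2)%:E)%E.
  by case: (hD r r0) => _ _ _ h _; exact: h.
have bC := hC m r f S G r0 sol; rewrite sqnorm_distC in bC.
have h2 := @sqnormD _ _ _ mu _ _ (measurable_funB (mavg _ rm) (mavg _ r0)) (mavg _ r0).
have h1 := @sqnormD _ _ _ mu _ _ (measurable_funB mf (mavg _ rm)) (mavg _ rm).
rewrite -lee_fin fineK; last exact: sqnorm_fin.
rewrite [sqnorm f](_ : _ = sqnorm (fun z => (f z - avg (r / 2 ^+ m) f z) + avg (r / 2 ^+ m) f z)%R); last first.
  by apply: eq_integral => z _; rewrite subrK.
apply: (le_trans h1).
rewrite [X in (_ * (_ + X))%E](_ : _ = sqnorm (fun z => (avg (r / 2 ^+ m) f z - avg r f z) + avg r f z)%R); last first.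
  by apply: eq_integral => z _; rewrite subrK.
apply: (@le_trans _ _ (2%:E * ((e / 2)%:E + 2%:E * ((C * r ^+ 2 * energy S G)%:E + (D / r ^+ Q * A ^+ 2)%:E)))%E).
  apply: lee_wpmul2l => //; apply: leeD => //; apply: (le_trans h2).
  by apply: lee_wpmul2l => //; exact: leeD.
rewrite -[leLHS]/((2 * (e / 2 + 2 * (C * r ^+ 2 * energy S G + D / r ^+ Q * A ^+ 2)))%:E) lee_fin.
have ri : 0 <= (r ^+ Q)^-1 by rewrite invr_ge0 exprn_ge0// ltW.
have c1 : 0 <= C * ((r ^+ Q)^-1 * A ^+ 2).
  by apply: mulr_ge0 => //; apply: mulr_ge0 => //; exact: sqr_ge0.
have c2 : 0 <= D * (r ^+ 2 * energy S G).
  by apply: mulr_ge0 => //; apply: mulr_ge0 => //; exact: sqr_ge0.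
move: c1 c2; set a := (r ^+ Q)^-1; set b := r ^+ 2; set u := energy S G; set w := A ^+ 2.
rewrite !mulrDr !mulrDl !mulrA; nra.
Qed.

End Telescoping.

(** The two terms balance at r^(k+2) = A^2 / e. If e or A vanishes no such positive r exists, but a
    very large or a very small r forces X = 0. *)
Lemma nash_optimization (R : realType) (k : nat) (K X e A : R) : (0 < k)%N ->
  0 <= K -> 0 <= X -> 0 <= e -> 0 <= A ->
  (forall r, 0 < r -> X <= K * (r ^+ 2 * e + (r ^+ k)^-1 * A ^+ 2)) ->
  Num.sqrt X `^ (1 + 2 / k%:R) <=
  Num.sqrt (2 * K) `^ (1 + 2 / k%:R) * Num.sqrt e * A `^ (2 / k%:R).
Proof.
move=> k0 K0 X0 e0 A0 hX.
have kR : 0 < k%:R :> R by rewrite ltr0n.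
have th : 0 < 1 + 2 / k%:R :> R by rewrite addr_gt0// divr_gt0.
have rhs0 : 0 <= Num.sqrt (2 * K) `^ (1 + 2 / k%:R) * Num.sqrt e * A `^ (2 / k%:R).
  by rewrite !mulr_ge0// powR_ge0.
have X0_case : X <= 0 -> Num.sqrt X `^ (1 + 2 / k%:R) <=
  Num.sqrt (2 * K) `^ (1 + 2 / k%:R) * Num.sqrt e * A `^ (2 / k%:R).
  by move=> /ler0_sqrtr ->; rewrite powR0// gt_eqF.
have [e1|e1] := eqVneq e 0.
  apply: X0_case; rewrite leNgt; apply/negP => Xp.
  (* Large enough that X r^k >= X r > K A^2; the first inequality uses k > 0. *)
  pose r := 1 + K * A ^+ 2 / X.
  have c0 : 0 <= K * A ^+ 2 by rewrite mulr_ge0// sqr_ge0.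
  have r1 : 1 <= r by rewrite lerDl divr_ge0// ltW.
  have rp : 0 < r by exact: lt_le_trans ltr01 r1.
  have := hX r rp; rewrite e1 mulr0 add0r mulrCA mulrC ler_pdivlMr ?exprn_gt0//.
  apply/negP; rewrite -ltNge; apply: (@lt_le_trans _ _ (X * r)).
    have -> : X * r = X + K * A ^+ 2 by rewrite /r; field; rewrite gt_eqF.
    by rewrite ltrDr.
  by rewrite ler_pM2l// -[leLHS]expr1 ler_weXn2l.
have [A1|A1] := eqVneq A 0.
  apply: X0_case; rewrite leNgt; apply/negP => Xp.
  (* Small enough that K r^2 e <= r K e < X. *)
  pose r := X / (X + K * e).
  have c0 : 0 <= K * e by rewrite mulr_ge0.
  have d0 : 0 < X + K * e by rewrite ltr_wpDr.
  have rp : 0 < r by rewrite divr_gt0.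
  have r1 : r <= 1 by rewrite ler_pdivrMr// mul1r lerDl.
  have r2 : r ^+ 2 <= r by rewrite -[leRHS]expr1 ler_wiXn2l// ltW.
  have := hX r rp; rewrite A1 expr0n /= mulr0 addr0 mulrCA.
  apply/negP; rewrite -ltNge; apply: (@le_lt_trans _ _ (r * (K * e))).
    exact: ler_wpM2r.
  by rewrite /r mulrAC ltr_pdivrMr// ltr_pM2l// ltrDr.
have ep : 0 < e by rewrite lt_def e1.
have Ap : 0 < A by rewrite lt_def A1.
pose s := Num.sqrt e.
have sp : 0 < s by rewrite sqrtr_gt0.
have es : e = s ^+ 2 by rewrite sqr_sqrtr.
(* The balancing scale, for which r^-k A^2 = r^2 e. *)
pose r := (A / s) `^ (2 / k.+2%:R).
have as0 : 0 < A / s by rewrite divr_gt0.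
have rp : 0 < r by exact: powR_gt0.
have rk : r ^+ k.+2 = (A / s) ^+ 2.
  rewrite -powR_mulrn ?(ltW rp)// -powRrM divfK ?pnatr_eq0//.
  by rewrite powR_mulrn// ltW.
have Xr : X <= 2 * K * (r * s) ^+ 2.
  apply: (le_trans (hX r rp)); rewrite (_ : (r ^+ k)^-1 * A ^+ 2 = r ^+ 2 * e).
    by rewrite es exprMn le_eqVlt; apply/orP; left; apply/eqP; ring.
  have -> : A ^+ 2 = r ^+ k.+2 * s ^+ 2 by rewrite rk -exprMn divfK ?gt_eqF.
  rewrite es -[k.+2]addn2 exprD; have : r ^+ k != 0 by rewrite expf_neq0// gt_eqF.
  by set a := r ^+ k => a0; field.
have sX : Num.sqrt X <= Num.sqrt (2 * K) * (r * s).
  rewrite -[X in _ * X](ger0_norm (ltW (mulr_gt0 rp sp))) -sqrtr_sqr -sqrtrM; last by rewrite mulr_ge0.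
  exact: ler_wsqrtr.
apply: (@le_trans _ _ ((Num.sqrt (2 * K) * (r * s)) `^ (1 + 2 / k%:R))).
  by apply: ge0_ler_powR => //; rewrite ?nnegrE ?mulr_ge0 ?(ltW rp) ?(ltW sp)// ltW.
rewrite powRM ?mulr_ge0 ?(ltW rp) ?(ltW sp)// -!mulrA ler_wpM2l ?powR_ge0//.
rewrite le_eqVlt; apply/orP; left; apply/eqP.
rewrite powRM ?(ltW rp) ?(ltW sp)// -powRrM.
(* This identity turns the exponent of A / s into that of A in the claim; one power of s = sqrt e is
   left over. *)
have -> : 2 / k.+2%:R * (1 + 2 / k%:R) = 2 / k%:R :> R.
  rewrite -[k.+2]addn2 natrD; field.
  by rewrite gt_eqF//= gt_eqF// addr_gt0.
have -> : s `^ (1 + 2 / k%:R) = s * s `^ (2 / k%:R).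
  by rewrite powRD ?powRr1 ?(ltW sp)// gt_eqF.
by rewrite mulrCA -powRM ?(ltW as0) ?(ltW sp)// divfK// gt_eqF//.
Qed.

Theorem mainTheorem5 (R : realType) (n : nat) :
  exists2 C : R, 0 < C &
  forall (f : (2 * n).+1.-tuple R -> R) (S G : 'I_n -> (2 * n).+1.-tuple R -> R),
    measurable_fun setT f ->
    (forall i, measurable_fun setT (S i)) ->
    (forall i, measurable_fun setT (G i)) ->
    (L1norm f < +oo)%E ->
    (L2sq f < +oo)%E ->
    (forall i, L2sq (G i) < +oo)%E ->
    (forall i, L2sq (S i) < +oo)%E ->
    (* G = nabla_v f in the sense of distributions *)
    (forall (i : 'I_n) (phi : (2 * n).+1.-tuple R -> R), test_fun phi ->
       integral_R (fun p => f p * pderiv (vidx i) phi p)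
       = oppe (integral_R (fun p => G i p * phi p))) ->
    (* (d_t + v . nabla_x) f = nabla_v . S in the sense of distributions *)
    (forall phi : (2 * n).+1.-tuple R -> R, test_fun phi ->
       integral_R (fun p => f p * (pderiv (tidx n) phi p
                    + \sum_(i < n) vcoord p i * pderiv (xidx i) phi p))
       = integral_R (fun p => \sum_(i < n) S i p * pderiv (vidx i) phi p)) ->
    Num.sqrt (fine (L2sq f)) `^ (1 + 2 / (2 + 4 * n%:R))
    <= C * Num.sqrt (\sum_(i < n) fine (L2sq (G i)) + \sum_(i < n) fine (L2sq (S i)))
         * fine (L1norm f) `^ (2 / (2 + 4 * n%:R)).
Proof.
have [K K0 hK] := @sqnorm_interpolation R n.
have QR : 2 + 4 * n%:R = (2 + 4 * n)%:R :> R by rewrite natrD natrM.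
(* The added 1 makes the constant positive even when K = 0. *)
exists (Num.sqrt (2 * K + 1) `^ (1 + 2 / (2 + 4 * n%:R))).
  by rewrite powR_gt0// sqrtr_gt0 ltr_wpDl// mulr_ge0.
move=> f S G mf mS mG f1 f2 G2 S2 dv tr.
have sol : weak_solution f S G.
  by split=> //; [split=> //; rewrite -L2sqE|move=> i; split=> //; rewrite -L2sqE..].
have -> : \sum_(i < n) fine (L2sq (G i)) + \sum_(i < n) fine (L2sq (S i)) = energy S G.
  by congr (_ + _); apply: eq_bigr => i _; rewrite L2sqE.
have A0 : (0 <= L1norm f)%E by rewrite L1normE//; apply: integral_ge0 => p _; rewrite lee_fin.
have fA : (\int[leb R _]_p `|f p|%:E = (fine (L1norm f))%:E)%E.
  by rewrite -L1normE// fineK// ge0_fin_numE.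
rewrite L2sqE// QR.
apply: le_trans (nash_optimization _ K0 (fine_sqnorm_ge0 f) (energy_ge0 S G) (fine_ge0 A0) _) _ => //.
  by move=> r r0; exact: hK.
rewrite !ler_wpM2r ?powR_ge0 ?sqrtr_ge0//.
have t0 : 0 <= 1 + 2 / (2 + 4 * n)%:R :> R by rewrite addr_ge0// divr_ge0.
apply: ge0_ler_powR; rewrite ?nnegrE ?sqrtr_ge0//.
by apply: ler_wsqrtr; rewrite lerDl.
Qed.
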